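(* Let $R$ be a ring and $R\text{-Mod}$ the category of left $R$-modules. Then the following are equivalent for any non-negative integer $m$: (1) $\sup\{\mathcal{G}\mathrm{pd}\,M\mid M\in R\text{-Mod}\}\leq m$; (2) $\sup\{\mathcal{G}\mathrm{id}\,M\mid M\in R\text{-Mod}\}\leq m$; (3) $\mathrm{spli}\,R=\mathrm{silp}\,R\leq m$. Moreover, $$\sup\{\mathcal{G}\mathrm{pd}\,M\mid M\in R\text{-Mod}\}=\sup\{\mathcal{G}\mathrm{id}\,M\mid M\in R\text{-Mod}\}.$$
   Context: $R$ is an associative ring with unit; modules are left modules. A module is Gorenstein projective if it is a syzygy (kernel/image of a differential) of an exact complex of projective modules $\cdots\to P_1\to P_0\to P_{-1}\to\cdots$ that remains exact under $\mathrm{Hom}_R(-,Q)$ for every projective $Q$. A module is Gorenstein injective if it is a syzygy of an exact complex of injective modules that remains exact under $\mathrm{Hom}_R(E,-)$ for every injective $E$. $\mathcal{G}\mathrm{pd}\,M$ (resp. $\mathcal{G}\mathrm{id}\,M$) is the Gorenstein projective (resp. injective) dimension: the least length of a resolution by Gorenstein projectives (resp. coresolution by Gorenstein injectives), or $\infty$. $\mathrm{silp}\,R=\sup\{\mathrm{id}\,P\mid P \text{ projective left }R\text{-module}\}$ and $\mathrm{spli}\,R=\sup\{\mathrm{pd}\,I\mid I\text{ injective left }R\text{-module}\}$, where $\mathrm{pd}$, $\mathrm{id}$ are the usual projective and injective dimensions. *)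

(* Defs.v *)
From HB Require Import structures.
From mathcomp Require Import all_boot all_order all_algebra.
From mathcomp Require Import boolp classical_sets constructive_ereal.

Set Implicit Arguments.
Unset Strict Implicit.
Unset Printing Implicit Defensive.

Import Order.TTheory GRing.Theory Num.Theory.
Local Open Scope classical_set_scope.
Local Open Scope ring_scope.

Section Modules.
Variable R : pzRingType.

Definition surjective_map (U V : Type) (f : U -> V) : Prop :=
  forall y, exists x, f x = y.

Definition exact_at (U V W : lmodType R) (f : U -> V) (g : V -> W) : Prop :=
  forall y : V, g y = 0 <-> exists x : U, f x = y.

Definition projective_module (P : lmodType R) : Prop :=
  forall (M N : lmodType R) (g : {linear M -> N}) (f : {linear P -> N}),
    surjective_map g -> exists h : {linear P -> M}, forall x, g (h x) = f x.

Definition injective_module (I : lmodType R) : Prop :=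
  forall (M N : lmodType R) (g : {linear M -> N}) (f : {linear M -> I}),
    injective g -> exists h : {linear N -> I}, forall x, h (g x) = f x.

(* 0 -> P n -> ... -> P 0 -> M -> 0 is exact with all the P i in C; the complex
   is continued by zero modules in degrees greater than n. *)
Definition has_resolution (C : lmodType R -> Prop) (M : lmodType R) (n : nat) :
    Prop :=
  exists (P : nat -> lmodType R) (d : forall i, {linear P i.+1 -> P i})
         (e : {linear P 0%N -> M}),
  [/\ forall i, (i <= n)%N -> C (P i),
      forall i, (n < i)%N -> forall x : P i, x = 0,
      surjective_map e,
      exact_at (d 0%N) e
    & forall i, exact_at (d i.+1) (d i)].

(* 0 -> M -> I 0 -> ... -> I n -> 0 is exact with all the I i in C. *)
Definition has_coresolution (C : lmodType R -> Prop) (M : lmodType R)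
    (n : nat) : Prop :=
  exists (I : nat -> lmodType R) (d : forall i, {linear I i -> I i.+1})
         (e : {linear M -> I 0%N}),
  [/\ forall i, (i <= n)%N -> C (I i),
      forall i, (n < i)%N -> forall x : I i, x = 0,
      injective e,
      exact_at e (d 0%N)
    & forall i, exact_at (d i) (d i.+1)].

(* In an unbounded complex X the differential d i goes from X (i + 1) to X i,
   so that d (i + 1) and d i are always composable. *)
Definition exact_complex (X : int -> lmodType R)
    (d : forall i, {linear X (i + 1) -> X i}) : Prop :=
  forall i, exact_at (d (i + 1)) (d i).

(* The complex Hom(X, Q) is exact (in every degree i + 1). *)
Definition Hom_into_exact (X : int -> lmodType R)
    (d : forall i, {linear X (i + 1) -> X i}) (Q : lmodType R) : Prop :=
  forall (i : int) (f : {linear X (i + 1) -> Q}),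
    (forall x, f (d (i + 1) x) = 0) <->
    exists g : {linear X i -> Q}, forall x, g (d i x) = f x.

(* The complex Hom(E, X) is exact (in every degree i + 1). *)
Definition Hom_from_exact (X : int -> lmodType R)
    (d : forall i, {linear X (i + 1) -> X i}) (E : lmodType R) : Prop :=
  forall (i : int) (f : {linear E -> X (i + 1)}),
    (forall x, d i (f x) = 0) <->
    exists g : {linear E -> X (i + 1 + 1)}, forall x, d (i + 1) (g x) = f x.

(* Up to isomorphism, M is the kernel of one of the differentials. *)
Definition is_syzygy (X : int -> lmodType R)
    (d : forall i, {linear X (i + 1) -> X i}) (M : lmodType R) : Prop :=
  exists (i : int) (j : {linear M -> X (i + 1)}),
    injective j /\ exact_at j (d i).

Definition Gorenstein_projective (M : lmodType R) : Prop :=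
  exists (X : int -> lmodType R) (d : forall i, {linear X (i + 1) -> X i}),
  [/\ forall i, projective_module (X i),
      exact_complex d,
      forall Q, projective_module Q -> Hom_into_exact d Q
    & is_syzygy d M].

Definition Gorenstein_injective (M : lmodType R) : Prop :=
  exists (X : int -> lmodType R) (d : forall i, {linear X (i + 1) -> X i}),
  [/\ forall i, injective_module (X i),
      exact_complex d,
      forall E, injective_module E -> Hom_from_exact d E
    & is_syzygy d M].

End Modules.

(* Dimensions live in \bar int. *)
Definition least_length (L : set nat) : \bar int :=
  infimum +oo%E [set (n%:Z)%:E%E | n in L].

(* The default value -oo is only taken on the empty set: every set of elements
   of \bar int has a least upper bound. *)
Definition sup_dim (A : set (\bar int)) : \bar int := supremum -oo%E A.

Section Dimensions.
Variable R : pzRingType.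

Definition pd (M : lmodType R) : \bar int :=
  least_length [set n | has_resolution (@projective_module R) M n].

Definition id_dim (M : lmodType R) : \bar int :=
  least_length [set n | has_coresolution (@injective_module R) M n].

Definition Gpd (M : lmodType R) : \bar int :=
  least_length [set n | has_resolution (@Gorenstein_projective R) M n].

Definition Gid (M : lmodType R) : \bar int :=
  least_length [set n | has_coresolution (@Gorenstein_injective R) M n].

End Dimensions.

(* The sets of values are written as comprehensions rather than as images of
   sets of modules, so that set is never applied to the large type lmodType R. *)
Section GlobalDimensions.
Variable R : pzRingType.

Definition silp : \bar int :=
  sup_dim [set a | exists2 P : lmodType R, projective_module P & id_dim P = a].

Definition spli : \bar int :=
  sup_dim [set a | exists2 I : lmodType R, injective_module I & pd I = a].

Definition sup_Gpd : \bar int :=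
  sup_dim [set a | exists M : lmodType R, Gpd M = a].

Definition sup_Gid : \bar int :=
  sup_dim [set a | exists M : lmodType R, Gid M = a].

End GlobalDimensions.

Arguments silp : clear implicits.
Arguments spli : clear implicits.
Arguments sup_Gpd : clear implicits.
Arguments sup_Gid : clear implicits.

(* Main.v *)
(* The argument only uses short exact sequences, enough projectives and enough
   injectives, in a self-dual way, so it is carried out in an abstract exact
   category; (1) <-> (3) for the opposite category is (2) <-> (3).

   If (1) holds with bound m, dimension shifting makes the m-th cosyzygies of
   projectives injective (silp <= m). Given silp <= m, Gorenstein projectives
   are exactly the objects with an infinite exact coresolution by projectives, a
   class closed under extensions; hence an object M with Ext^1(G, M) = 0 for all
   G in this class and Gpd M <= m has pd M <= m, which applies to injective M
   (spli <= m). Conversely, if silp, spli <= m, embedding M into an injective I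
   and taking m-th syzygies embeds Omega^m M into the projective Omega^m I with
   cokernel an m-th syzygy, so iterating shows that Omega^m M is Gorenstein
   projective. Finally Ext^1(Omega^b M, Q) = 0 for Q projective and b = silp, so
   finite projective dimensions are at most silp; this and its dual give
   spli = silp. *)

Require Import Defs.
From mathcomp Require Import all_boot all_order all_algebra.
From HB Require Import structures.
From mathcomp Require Import boolp classical_sets constructive_ereal.

Set Implicit Arguments.
Unset Strict Implicit.
Unset Printing Implicit Defensive.

Import Order.TTheory GRing.Theory Num.Theory.
Local Open Scope ring_scope.

(** * Homological algebra in a self-dual axiomatic setting *)

(** No Ext group is ever formed. The vanishing of Ext^1 is a lifting property, and the vanishing of
    Ext^(n+1)(M, X) is read as [ext0 M Y] for an n-th cosyzygy [Y] of [X], or as [ext0 K X] for an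
    n-th syzygy [K] of [M]. Passing between these readings replaces long exact sequences, and it
    needs projectives on one side and injectives on the other. Being Gorenstein projective is
    treated coinductively, as membership in a class closed under one step to the left and one to the
    right. Unbounded complexes therefore occur only in the module part, where they are cut into
    short exact sequences and spliced back. The pullback and pushout axioms give only the resulting
    exact sequences, with no commuting squares. That is enough here because all later steps ask only
    which objects fit into which sequences. The comparison of [spli] with [silp] presupposes that
    both are finite: this is what lets a syzygy be pushed far enough to become projective. *)

(* All the axioms are stated in pairs exchanged by reversing the arrows, so that
   every result holds in the opposite category, with projective and injective
   objects exchanged. *)
Record excat := Excat {
  obj : Type;
  hom : obj -> obj -> Type;
  idm : forall A, hom A A;
  comp : forall A B C, hom B C -> hom A B -> hom A C;
  zerom : forall A B, hom A B;
  subm : forall A B, hom A B -> hom A B -> hom A B;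
  ses : forall A B C, hom A B -> hom B C -> Prop;
  compmA : forall A B C D (h : hom C D) (g : hom B C) (f : hom A B),
    comp h (comp g f) = comp (comp h g) f;
  comp1m : forall A B (f : hom A B), comp (idm B) f = f;
  compm1 : forall A B (f : hom A B), comp f (idm A) = f;
  submm : forall A B (f : hom A B), subm f f = zerom A B;
  subKm : forall A B (f g : hom A B), subm f (subm f g) = g;
  comp_subl : forall A B C (f g : hom B C) (h : hom A B),
    comp (subm f g) h = subm (comp f h) (comp g h);
  comp_subr : forall A B C (f g : hom A B) (h : hom B C),
    comp h (subm f g) = subm (comp h f) (comp h g);
  ses_comp0 : forall A B C (i : hom A B) (p : hom B C),
    ses i p -> comp p i = zerom A C;
  ses_mono : forall A B C (i : hom A B) (p : hom B C) X (f : hom X A),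
    ses i p -> comp i f = zerom X B -> f = zerom X A;
  ses_epi : forall A B C (i : hom A B) (p : hom B C) X (f : hom C X),
    ses i p -> comp f p = zerom B X -> f = zerom C X;
  ses_ker : forall A B C (i : hom A B) (p : hom B C) X (f : hom X B),
    ses i p -> comp p f = zerom X C -> exists g, comp i g = f;
  ses_coker : forall A B C (i : hom A B) (p : hom B C) X (f : hom B X),
    ses i p -> comp f i = zerom A X -> exists g, comp g p = f;
  ses_flip : forall A B C (i : hom A B) (p : hom B C) (r : hom B A)
      (s : hom C B),
    ses i p -> comp r i = idm A -> comp p s = idm C -> comp r s = zerom C A ->
    ses s r;
  ses_zero : exists Z, [/\ forall A (f : hom A Z), f = zerom A Z,
    forall A (f : hom Z A), f = zerom Z A,
    forall A, exists (i : hom A A) (p : hom A Z), ses i p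
    & forall A, exists (i : hom Z A) (p : hom A A), ses i p];
  ses_pullback_mono : forall K P G A M
      (i : hom K P) (p : hom P G) (j : hom A G) (q : hom G M),
    ses i p -> ses j q -> exists L,
    (exists (k : hom L P) (l : hom P M), ses k l) /\
    (exists (k : hom K L) (l : hom L A), ses k l);
  ses_pushout_epi : forall K P G A M
      (i : hom P K) (p : hom G P) (j : hom G A) (q : hom M G),
    ses p i -> ses q j -> exists L,
    (exists (k : hom P L) (l : hom M P), ses l k) /\
    (exists (k : hom L K) (l : hom A L), ses l k);
  ses_pullback_epi : forall A B C K X
      (i : hom A B) (p : hom B C) (j : hom K X) (q : hom X C),
    ses i p -> ses j q -> exists Y,
    (exists (k : hom A Y) (l : hom Y X), ses k l) /\
    (exists (k : hom K Y) (l : hom Y B), ses k l);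
  ses_pushout_mono : forall A B C K X
      (i : hom B A) (p : hom C B) (j : hom X K) (q : hom C X),
    ses p i -> ses q j -> exists Y,
    (exists (k : hom Y A) (l : hom X Y), ses l k) /\
    (exists (k : hom Y K) (l : hom B Y), ses l k);
  enough_proj : forall M, exists K P (i : hom K P) (p : hom P M), ses i p /\
    forall A B C (j : hom A B) (q : hom B C) (f : hom P C),
      ses j q -> exists g, comp q g = f;
  enough_inj : forall M, exists K I (i : hom I K) (p : hom M I), ses p i /\
    forall A B C (j : hom B A) (q : hom C B) (f : hom C I),
      ses q j -> exists g, comp g q = f
}.

(** The data fields reduce to those of [C] with arrows reversed, so a lemma applied to [opcat C]
    yields its dual in [C] by conversion. *)
Definition opcat (C : excat) : excat :=
  @Excat (obj C) (fun A B => @hom C B A) (@idm C)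
    (fun X Y Z g f => @comp C Z Y X f g) (fun A B => @zerom C B A)
    (fun A B => @subm C B A) (fun X Y Z i p => @ses C Z Y X p i)
    (fun W X Y Z h g f => esym (@compmA C Z Y X W f g h))
    (fun X Y => @compm1 C Y X) (fun X Y => @comp1m C Y X)
    (fun X Y => @submm C Y X) (fun X Y => @subKm C Y X)
    (fun X Y Z f g h => @comp_subr C Z Y X f g h)
    (fun X Y Z f g h => @comp_subl C Z Y X f g h)
    (fun X Y Z i p => @ses_comp0 C Z Y X p i)
    (fun X Y Z i p => @ses_epi C Z Y X p i)
    (fun X Y Z i p => @ses_mono C Z Y X p i)
    (fun X Y Z i p => @ses_coker C Z Y X p i)
    (fun X Y Z i p => @ses_ker C Z Y X p i)
    (fun X Y Z i p r s h1 h2 h3 h4 => @ses_flip C Z Y X p i s r h1 h3 h2 h4)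
    (let: ex_intro Z (And4 a b c d) := ses_zero C in
     ex_intro _ Z
       (And4 b a (fun A => let: ex_intro i (ex_intro p h) := d A in
                           ex_intro _ p (ex_intro _ i h))
                 (fun A => let: ex_intro i (ex_intro p h) := c A in
                           ex_intro _ p (ex_intro _ i h))))
    (@ses_pushout_epi C) (@ses_pullback_mono C)
    (@ses_pushout_mono C) (@ses_pullback_epi C)
    (@enough_inj C) (@enough_proj C).

(** * Vanishing of Ext^1, splitting and one-step dimension shifting *)

Section Ext.
Variable C : excat.
Local Notation "g \c f" := (comp g f) (at level 40, left associativity).
Local Notation "f \s g" := (subm f g) (at level 50, left associativity).

Definition exact3 (A B D : obj C) : Prop :=
  exists (i : hom A B) (p : hom B D), ses i p.

(* Vanishing of Ext^1(N, Q), in two forms exchanged by duality. *)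
Definition ext0 (N Q : obj C) : Prop :=
  forall E F (i : hom Q E) (p : hom E F), ses i p ->
  forall f : hom N F, exists g, p \c g = f.

Definition coext0 (N Q : obj C) : Prop :=
  forall E F (p : hom E N) (i : hom F E), ses i p ->
  forall f : hom F Q, exists g, g \c i = f.

Definition proj (P : obj C) : Prop := forall Q, ext0 P Q.
Definition inj (I : obj C) : Prop := forall N, coext0 N I.

Lemma subm0 (A B : obj C) (f : hom A B) : f \s zerom A B = f.
Proof. by rewrite -(submm f) subKm. Qed.

Lemma subm_eq0 (A B : obj C) (f g : hom A B) : f \s g = zerom A B -> f = g.
Proof. by move=> fg; rewrite -(subm0 f) -fg subKm. Qed.

Lemma compm0 (A B D : obj C) (f : hom B D) : f \c zerom A B = zerom A D.
Proof. by rewrite -(submm (zerom A B)) comp_subr submm. Qed.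

Lemma comp0m (A B D : obj C) (f : hom A B) : zerom B D \c f = zerom A D.
Proof. by rewrite -(submm (zerom B D)) comp_subl submm. Qed.

Lemma ex_proj M : exists K P, proj P /\ exact3 K P M.
Proof.
have [K [P [i [p [h hP]]]]] := enough_proj M.
exists K, P; split; last by exists i, p.
by move=> Q E F j q hjq f; exact: hP hjq.
Qed.

(** Embed [Q] in an injective [J], where the extension [g] exists. The obstruction to [g] landing in
    [Q] is a map from [N] to the cokernel of [Q] in [J]; [ext0] lifts it to [J], and subtracting the
    lift corrects [g] without changing it on the subobject. *)
Lemma coext0_ext0 N Q : ext0 N Q -> coext0 N Q.
Proof.
move=> NQ B A p i hip f.
have [K [J [q [j [hjq hJ]]]]] := enough_inj Q.
have [g gE] := hJ _ _ _ _ _ (j \c f) hip.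
have [h hE] : exists h, h \c p = q \c g.
  by apply: (ses_coker hip); rewrite -compmA gE compmA (ses_comp0 hjq) comp0m.
have [k kE] := NQ _ _ _ _ hjq h.
have [l lE] : exists l, j \c l = g \s k \c p.
  by apply: (ses_ker hjq); rewrite comp_subr compmA kE hE submm.
exists l; apply: subm_eq0; apply: (ses_mono hjq).
rewrite comp_subr compmA lE comp_subl -compmA (ses_comp0 hip) compm0.
by rewrite subm0 gE submm.
Qed.

Lemma split_section (A B D : obj C) (i : hom A B) (p : hom B D) (s : hom D B) :
  ses i p -> p \c s = idm D ->
  exists r, [/\ r \c i = idm A, r \c s = zerom D A & i \c r = idm B \s s \c p].
Proof.
move=> hip ps.
have [r rE] : exists r, i \c r = idm B \s s \c p.
  by apply: (ses_ker hip); rewrite comp_subr compm1 compmA ps comp1m submm.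
exists r; split=> //.
  apply: subm_eq0; apply: (ses_mono hip).
  rewrite comp_subr compmA rE comp_subl comp1m compm1 -compmA (ses_comp0 hip).
  by rewrite compm0 subm0 submm.
apply: (ses_mono hip).
by rewrite compmA rE comp_subl comp1m -compmA ps compm1 submm.
Qed.

(** The identity of [D] lifts, so the sequence splits and can be read backwards. [ex_horseshoe]
    needs this to pull back along a map onto the former subobject. *)
Lemma ext0_split A B D : exact3 A B D -> ext0 D A -> exact3 D B A.
Proof.
move=> [i [p hip]] DA; have [s ps] := DA _ _ _ _ hip (idm D).
by have [r [ri rs _]] := split_section hip ps; exists s, r; exact: (ses_flip hip).
Qed.

Lemma proj_split K P M : exact3 K P M -> proj P -> ext0 M K -> proj M.
Proof.
move=> [i [p hip]] hP MK Q E F j q hjq f.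
have [s ps] := MK _ _ _ _ hip (idm M).
have [g gE] := hP _ _ _ _ _ hjq (f \c p).
by exists (g \c s); rewrite compmA gE -compmA ps compm1.
Qed.

(** Lift [f] on [A], then extend that lift to [B], which is possible since [D] is projective. The
    error vanishes on [A], hence factors through [D] and lifts in turn. *)
Lemma proj_ex A B D : exact3 A B D -> proj A -> proj D -> proj B.
Proof.
move=> [i [p hip]] hA hD Q E F j q hjq f.
have [g gE] := hA _ _ _ _ _ hjq (f \c i).
have [h hE] := coext0_ext0 (hD E) hip g.
have [k kE] : exists k, k \c p = q \c h \s f.
  by apply: (ses_coker hip); rewrite comp_subl -compmA hE gE submm.
have [l lE] := hD _ _ _ _ _ hjq k.
by exists (h \s l \c p); rewrite comp_subr compmA lE kE subKm.
Qed.

(* The remaining half of the long exact sequence of Ext(-, Q). *)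
Lemma ext0_coker (A B D Q : obj C) (i : hom A B) (p : hom B D) :
  ses i p -> ext0 B Q -> (forall f : hom A Q, exists g, g \c i = f) -> ext0 D Q.
Proof.
move=> hip BQ surj E F j q hjq f.
have [s sE] := BQ _ _ _ _ hjq (f \c p).
have [a aE] : exists a, j \c a = s \c i.
  by apply: (ses_ker hjq); rewrite compmA sE -compmA (ses_comp0 hip) compm0.
have [h hE] := surj a.
have [g gE] : exists g, g \c p = s \s j \c h.
  by apply: (ses_coker hip); rewrite comp_subl -compmA hE aE submm.
exists g; apply: subm_eq0; apply: (ses_epi hip).
rewrite comp_subl -compmA gE comp_subr compmA (ses_comp0 hjq) comp0m.
by rewrite subm0 sE submm.
Qed.

(* Dimension shifting: Ext^1(D, Q') = Ext^2(D, Q) = Ext^1(A, Q). *)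
Lemma ext0_shift (A B D Q I Q' : obj C) :
  exact3 A B D -> exact3 Q I Q' -> ext0 A Q -> inj I -> ext0 B Q' -> ext0 D Q'.
Proof.
move=> [i [p hip]] [j [q hjq]] AQ hI BQ.
apply: (ext0_coker hip BQ) => f.
have [f1 f1E] := AQ _ _ _ _ hjq f; have [g1 g1E] := hI _ _ _ _ _ hip f1.
by exists (q \c g1); rewrite -compmA g1E.
Qed.

End Ext.

Lemma ext0_coext0 (C : excat) (N Q : obj C) : coext0 N Q -> ext0 N Q.
Proof. exact: (@coext0_ext0 (opcat C) Q N). Qed.

Lemma op_ex (C : excat) (A B D : obj C) :
  @exact3 (opcat C) A B D <-> @exact3 C D B A.
Proof. by split=> -[i [p h]]; exists p, i. Qed.

(** * Resolutions, syzygies and the horseshoe construction *)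

Section Dimension.
Variable C : excat.
Implicit Types (A B D M N P Q K L : obj C) (G : obj C -> Prop).

(** The shift in the direction opposite to [ext0_shift]: Ext^1(N, Q) = Ext^2(N', Q), which lies
    between Ext^1(N', Q') and Ext^2(N', J) = Ext^1(N, J). *)
Lemma coext0_shift P N N' Q J Q' :
  exact3 N P N' -> exact3 Q J Q' -> ext0 N' Q' -> proj P -> ext0 N J -> ext0 N Q.
Proof.
move=> hN hQ NQ hP NJ; apply: ext0_coext0.
apply: (@ext0_shift (opcat C) Q' J Q N' P N); try exact/op_ex.
- exact: (coext0_ext0 NQ).
- exact: hP.
- exact: (coext0_ext0 NJ).
Qed.

Lemma inj_ext0 N I : inj I -> ext0 N I.
Proof. by move=> hI; apply: ext0_coext0; apply: hI. Qed.

Lemma ex_inj M : exists I K, inj I /\ exact3 M I K.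
Proof.
by have [K [I [hI /op_ex hM]]] := @ex_proj (opcat C) M; exists I, K.
Qed.

Lemma ex_pullback_mono K P D A M :
  exact3 K P D -> exact3 A D M -> exists L, exact3 L P M /\ exact3 K L A.
Proof. by move=> [i [p h]] [j [q h']]; exact: ses_pullback_mono h h'. Qed.

Lemma ex_pullback_epi A B D K L :
  exact3 A B D -> exact3 K L D -> exists M, exact3 A M L /\ exact3 K M B.
Proof. by move=> [i [p h]] [j [q h']]; exact: ses_pullback_epi h h'. Qed.

(** Pull [Q] back along the map from [B] to [D]. The result is an extension of [Q] by [A], so it
    splits and maps onto [A]; pulling [P] back along that map gives [M], and composing the two
    epimorphisms gives the kernel [N]. *)
Lemma ex_horseshoe A B D P Q K L :
  exact3 A B D -> exact3 K P A -> exact3 L Q D -> ext0 Q A ->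
  exists M N, [/\ exact3 Q M P, exact3 N M B & exact3 K N L].
Proof.
move=> hB hP hQ QA; have [Y [hY hYB]] := ex_pullback_epi hB hQ.
have [M [hM hMY]] := ex_pullback_epi (ext0_split hY QA) hP.
by have [N [hN hNL]] := ex_pullback_mono hMY hYB; exists M, N.
Qed.

Fixpoint res G M n : Prop :=
  if n is n'.+1 then exists K P, [/\ exact3 K P M, G P & res G K n'] else G M.

(** A relation, because a syzygy depends on the projectives chosen at each stage. *)
Fixpoint syz n M K : Prop :=
  if n is n'.+1 then exists M1 P, [/\ exact3 M1 P M, proj P & syz n' M1 K]
  else M = K.

Lemma syz_add a b M K :
  syz (a + b) M K <-> exists2 L, syz a M L & syz b L K.
Proof.
elim: a M => [|a IH] M.
  by split=> [h|[L <-]//]; exists M.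
split=> [[M1 [P [h hP /IH[L h1 h2]]]]|[L [M1 [P [h hP h1]]] h2]].
  by exists L => //; exists M1, P.
by exists M1, P; split=> //; apply/IH; exists L.
Qed.

Lemma syz1 K P M : exact3 K P M -> proj P -> syz 1 M K.
Proof. by exists K, P. Qed.

Lemma syz_rcons n M K :
  syz n.+1 M K <-> exists K' P, [/\ syz n M K', exact3 K P K' & proj P].
Proof.
rewrite -addn1 syz_add; split=> [[L hL [K' [P [h hP /= <-]]]]|].
  by exists L, P.
by move=> [K' [P [h h1 hP]]]; exists K' => //; exact: syz1 h1 hP.
Qed.

Lemma ex_syz n M : exists K, syz n M K.
Proof.
elim: n => [|n [K hK]]; first by exists M.
by have [K' [P [hP h]]] := ex_proj K; exists K'; apply/syz_rcons; exists K, P.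
Qed.

Lemma res_syz G n M K :
  (forall P, proj P -> G P) -> syz n M K -> G K -> res G M n.
Proof.
move=> hG; elim: n M => [|n IH] M /=; first by move=> ->.
by move=> [M1 [P [h hP h1]]] hK; exists M1, P; split=> //; [exact: hG|exact: IH].
Qed.

End Dimension.

Definition cosyz (C : excat) n (M K : obj C) := @syz (opcat C) n M K.
Definition cores (C : excat) G (M : obj C) n := @res (opcat C) G M n.

(** * Higher Ext vanishing, Gorenstein projectives and the bounds on [silp] and [spli] *)

Section Dimension2.
Variable C : excat.
Implicit Types (A B D M N P Q K L : obj C) (G : obj C -> Prop).

(** [I] need not be injective: [rcore_extension] takes projective [I] and [J], with Ext^1(D, I) = 0
    supplied by the finite injective dimension of [I]. *)
Lemma ex_cohorseshoe A B D I J K L :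
  exact3 A B D -> exact3 A I K -> exact3 D J L -> ext0 D I ->
  exists M N, [/\ exact3 J M I, exact3 B M N & exact3 K N L].
Proof.
move=> hB hI hJ DI; move/op_ex in hB; move/op_ex in hI; move/op_ex in hJ.
have [M [N [/op_ex h1 /op_ex h2 /op_ex h3]]] :=
  @ex_horseshoe (opcat C) _ _ _ _ _ _ _ hB hJ hI (coext0_ext0 DI).
by exists M, N.
Qed.

Lemma cosyz_rcons n M K :
  cosyz n.+1 M K <-> exists K' I, [/\ cosyz n M K', exact3 K' I K & inj I].
Proof.
split=> [/syz_rcons|] [K' [I [h h1 hI]]]; first by exists K', I; split=> //; apply/op_ex.
by apply/syz_rcons; exists K', I; split=> //; apply/op_ex.
Qed.

Lemma ex_cosyz n M : exists K, cosyz n M K.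
Proof. exact: (@ex_syz (opcat C)). Qed.

(** The hypothesis says that Ext^(k+1)(P, X) = 0 for all [k] and all [P] in [G], so a resolution of
    length [n] by [G] forces Ext^(n+1)(M, X) = 0, and this group is Ext^1(M, Y). *)
Lemma res_ext0 G n M X Y :
  (forall k P Z, G P -> cosyz k X Z -> ext0 P Z) ->
  res G M n -> cosyz n X Y -> ext0 M Y.
Proof.
move=> hG; elim: n M Y => [|n IH] M Y; first by move=> hM hXY; apply: hG hXY.
move=> [K [P [h hP hK]]] hXY; have := hXY => /cosyz_rcons[X' [I [hX h1 hI]]].
exact: (ext0_shift h h1 (IH _ _ hK hX) hI (hG _ _ _ hP hXY)).
Qed.

Lemma ext0_syz n M K X Y :
  syz n M K -> cosyz n X Y -> ext0 M Y -> ext0 K X.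
Proof.
elim: n M Y => [|n IH] M Y /=; first by move=> <- <-.
move=> [M1 [P [h hP hK]]] /cosyz_rcons[X' [I [hX h1 hI]]] MY.
exact: IH hK hX (coext0_shift h h1 MY hP (inj_ext0 hI)).
Qed.

(** Plays the role of Schanuel's lemma: Ext^1(K, X) = Ext^(n+1)(M, X) can be computed from the given
    resolution, although [K] may come from another one. *)
Lemma syz_proj n M K : res (@proj C) M n -> syz n M K -> proj K.
Proof.
move=> hM hK X; have [Y hY] := ex_cosyz n X.
by apply: ext0_syz hK hY (res_ext0 _ hM hY) => k P Z hP _; apply: hP.
Qed.

Lemma syz_of_proj n P K : proj P -> syz n P K -> proj K.
Proof.
elim: n P => [|n IH] P hP /=; first by move=> <-.
move=> [M1 [P1 [h hP1]]]; apply: IH => X.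
have [X' [J [hJ hX]]] := ex_inj X.
exact: coext0_shift h hX (hP _) hP1 (inj_ext0 hJ).
Qed.

(* The members of some class of objects each of which embeds into a projective
   object with cokernel in the class. *)
Definition rcore M : Prop := exists2 G : obj C -> Prop, G M &
  forall N, G N -> exists P N', [/\ proj P, exact3 N P N' & G N'].

Lemma rcore_unfold M :
  rcore M -> exists P N, [/\ proj P, exact3 M P N & rcore N].
Proof.
move=> [G hM hG]; have [P [N [hP h hN]]] := hG _ hM.
by exists P, N; split=> //; exists G.
Qed.

(** Coinduction with an exit: the cokernel may leave [G] as soon as it is already known to be in
    [rcore]. *)
Lemma rcore_coind G M : G M ->
  (forall N, G N -> exists P N', [/\ proj P, exact3 N P N' & G N' \/ rcore N']) ->
  rcore M.
Proof.
move=> hM hG; exists (fun N => G N \/ rcore N); first by left.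
move=> N [/hG[P [N' [hP h hN]]]|/rcore_unfold[P [N' [hP h hN]]]].
  by exists P, N'.
by exists P, N'; split=> //; right.
Qed.

Lemma rcore_ker K P M : exact3 K P M -> proj P -> rcore M -> rcore K.
Proof.
move=> h hP hM; apply: (@rcore_coind (fun N => N = K)) => // N ->.
by exists P, M; split=> //; right.
Qed.

Lemma proj_rcore P : proj P -> rcore P.
Proof.
have [Z [_ Z0 PPZ _]] := ses_zero C; move=> hP.
have hZ : proj Z by move=> Q E F i p h f; exists (zerom Z E); rewrite compm0 [RHS]Z0.
apply: (@rcore_coind (@proj C)) => // N hN.
by exists N, Z; split=> //; left.
Qed.

(** Move one step along the coresolution of [Q] and one step along the projective embeddings of [M]
    at the same time; after [n] steps the second argument is injective. *)
Lemma rcore_ext0 n M Q :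
  cores (@inj C) Q n -> rcore M -> ext0 M Q.
Proof.
elim: n M Q => [|n IH] M Q; first by move=> hQ _; apply: inj_ext0.
move=> [Q' [I [/op_ex h hI hQ']]] /rcore_unfold[P [N [hP h1 hN]]].
exact: coext0_shift h1 h (IH _ _ hQ' hN) hP (inj_ext0 hI).
Qed.

Definition silp_le n := forall P : obj C, proj P -> cores (@inj C) P n.
Definition spli_le n := forall I : obj C, inj I -> res (@proj C) I n.

(* The characterization of Gorenstein projective objects by syzygies: the class
   [G] consists of the syzygies of a totally acyclic complex. *)
Definition gproj M : Prop := exists2 G : obj C -> Prop, G M &
  forall N, G N ->
    [/\ exists P N', [/\ proj P, exact3 N P N' & G N'],
        exists P N', [/\ proj P, exact3 N' P N & G N']
      & forall Q, proj Q -> ext0 N Q].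

Lemma gproj_rcore M : gproj M -> rcore M.
Proof. by move=> [G hM hG]; exists G => // N /hG[]. Qed.

(** The left half of the complex comes from any projective resolution: a kernel [K] of a map from a
    projective onto [N] embeds in that projective with cokernel [N], so it is again in [rcore]. *)
Lemma rcore_gproj n M : silp_le n -> rcore M -> gproj M.
Proof.
move=> hn hM; exists rcore => // N hN; split; first exact: rcore_unfold.
  have [K [P [hP h]]] := ex_proj N.
  by exists P, K; split=> //; exact: rcore_ker h hP hN.
by move=> Q hQ; apply: rcore_ext0 (hn _ hQ) hN.
Qed.

(** This is Ext^(k+1)(M, P) = 0, shifted down to Ext^1 by moving [k] steps to the left in the
    complex of [M]. *)
Lemma gproj_ext0_cosyz k M P X : proj P -> gproj M -> cosyz k P X -> ext0 M X.
Proof.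
move=> hP [G hM hG].
elim: k M X hM => [|k IH] M X hM; first by move=> <-; have [_ _] := hG _ hM; apply.
move=> /cosyz_rcons[X' [I [hX h hI]]].
have [_ [Q [N [hQ h1 hN]]] _] := hG _ hM.
exact: ext0_shift h1 h (IH _ _ hN hX) hI (hQ _).
Qed.

Lemma gproj_silp n : (forall M, res gproj M n) -> silp_le n.
Proof.
move=> hn P hP; have [X hX] := ex_cosyz n P.
apply: (@res_syz (opcat C) _ n P X) => // N; apply: coext0_ext0.
apply: res_ext0 (hn N) hX => k M Z hM; exact: gproj_ext0_cosyz.
Qed.

(** Coinduction on the class of all extensions of [rcore] objects. The projective embeddings of the
    two ends combine because Ext^1(D, I) = 0, and the cokernel is an extension of their
    cokernels. *)
Lemma rcore_extension n A B D : silp_le n ->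
  exact3 A B D -> rcore A -> rcore D -> rcore B.
Proof.
move=> hn h hA hD; apply: (@rcore_coind (fun N => exists A D,
  [/\ exact3 A N D, rcore A & rcore D])); first by exists A, D.
move=> {A B D h hA hD} B [A [D [h /rcore_unfold[I [K [hI hA hK]]] hD]]].
have [J [L [hJ h1 hL]]] := rcore_unfold hD.
have [|M [N [hM hN hNL]]] := ex_cohorseshoe h hA h1.
  exact: rcore_ext0 (hn _ hI) hD.
by exists M, N; split; [exact: proj_ex hM hJ hI| |left; exists K, L].
Qed.

(** Pull the first term of the resolution of [D] back to [B]: its kernel stays the same, and the new
    term is an extension of the old one by [A]. *)
Lemma res_rcore_extension m n A B D : silp_le m ->
  exact3 A B D -> rcore A -> res rcore D n -> res rcore B n.
Proof.
case: n => [|n] hm h hA; first exact: rcore_extension hm h hA.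
move=> [K [P [h1 hP hK]]].
have [Y [h2 h3]] := ex_pullback_epi h h1.
by exists K, Y; split=> //; exact: rcore_extension hm h2 hA hP.
Qed.

(** The first term [D] of the resolution is replaced by a projective [P] mapping onto it. The new
    kernel [L] inherits the orthogonality to [rcore], and it has an [rcore] resolution one step
    shorter. *)
Lemma rcore_perp_res m n M : silp_le m ->
  (forall N, rcore N -> ext0 N M) -> res rcore M n -> res (@proj C) M n.
Proof.
move=> hm; elim: n M => [|n IH] M hM.
  (* Orthogonality to the cokernel [N] makes [M] a retract of the projective [P]. *)
  move=> /rcore_unfold[P [N [hP [i [p hip]] hN]]].
  have [r rE] := coext0_ext0 (hM _ hN) hip (idm M) => Q E F j q hjq f.
  have [g gE] := hP _ _ _ _ _ hjq (comp f r).
  by exists (comp g i); rewrite compmA gE -compmA rE compm1.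
move=> [K [D [h hD hK]]]; have [D' [P [hP h1]]] := ex_proj D.
have [L [hL hDL]] := ex_pullback_mono h1 h.
exists L, P; split=> //; apply: IH.
  move=> N hN; have [P' [N' [hP' h2 hN']]] := rcore_unfold hN.
  exact: coext0_shift h2 hL (hM _ hN') hP' (rcore_ext0 (hm _ hP) hN).
exact: res_rcore_extension hm hDL (rcore_ker h1 hP hD) hK.
Qed.

Lemma res_mono G G' M n : (forall N, G N -> G' N) -> res G M n -> res G' M n.
Proof.
move=> GG'; elim: n M => [|n IH] M; first exact: GG'.
by move=> [K [P [h hP hK]]]; exists K, P; split=> //; [exact: GG'|exact: IH].
Qed.

Lemma gproj_spli n : (forall M, res gproj M n) -> spli_le n.
Proof.
move=> hn I hI; apply: rcore_perp_res (gproj_silp hn) _ _.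
  by move=> N _; apply: inj_ext0.
by apply: res_mono (hn I) => N; apply: gproj_rcore.
Qed.

(** The horseshoe keeps the kernel prescribed over [A], so any given syzygy [K] can be embedded; the
    coinduction in [res_gproj] relies on this freedom. *)
Lemma syz_horseshoe n A B D K : exact3 A B D -> syz n A K ->
  exists L N, [/\ syz n B L, syz n D N & exact3 K L N].
Proof.
elim: n A B D => [|n IH] A B D h /=; first by move=> <-; exists B, D.
move=> [A1 [P [hA hP hK]]]; have [D1 [Q [hQ hD]]] := ex_proj D.
have [M [B1 [hM hB h1]]] := ex_horseshoe h hA hD (hQ _).
have [L [N [hL hN h2]]] := IH _ _ _ h1 hK.
exists L, N; split=> //; first by exists B1, M; split=> //; exact: proj_ex hM hQ hP.
by exists D1, Q.
Qed.

Lemma res_gproj n : silp_le n -> spli_le n -> forall M, res gproj M n.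
Proof.
move=> hs hp M; have [K hK] := ex_syz n M.
apply: (res_syz _ hK).
  by move=> P hP; exact: rcore_gproj hs (proj_rcore hP).
apply: rcore_gproj hs _.
apply: (@rcore_coind (fun K => exists M, syz n M K)); first by exists M.
move=> {M K hK} K [M hK]; have [I [M' [hI h]]] := ex_inj M.
have [L [N [hL hN h1]]] := syz_horseshoe h hK.
exists L, N; split=> //; first exact: (syz_proj (hp _ hI) hL).
by left; exists M'.
Qed.

(** Ext^1(K, Q) = Ext^(b+1)(M, Q), beyond the injective dimension of [Q]. *)
Lemma ext0_syz_cores b M K Q :
  cores (@inj C) Q b -> syz b M K -> ext0 K Q.
Proof.
elim: b K Q => [|b IH] K Q; first by move=> hQ _; apply: inj_ext0.
move=> [Q' [I [/op_ex h hI hQ']]] /syz_rcons[K' [P [hK h1 hP]]].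
exact: coext0_shift h1 h (IH _ _ hQ' hK) hP (inj_ext0 hI).
Qed.

Lemma silp_spli b m : silp_le b -> spli_le m -> spli_le b.
Proof.
move=> hb hm I hI; have [K hK] := ex_syz b I.
apply: (@res_syz C _ b I K) => //.
have [L hL] := ex_syz m K.
(* Regroup the [b + m] steps: [L] is also a [b]-th syzygy of an [m]-th syzygy of [I], and the latter
   is projective. *)
have [L0 h1 h2] : exists2 L0, syz m I L0 & syz b L0 L.
  by apply/syz_add; rewrite addnC; apply/syz_add; exists K.
have {h1 h2} : proj L := syz_of_proj (syz_proj (hm _ hI) h1) h2.
elim: m {hm L0 hI} I K hK hL => [|n IH] I K hK; first by move=> /= ->.
move=> [K1 [P [h hP hL]]] hL'.
(* Descent from [L] back to [K]: regarding [K1] as a [b]-th syzygy of [M1], induction makes it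
   projective. Its injective dimension is then at most [b], so the sequence from [K1] to [K]
   splits. *)
have /= [M1 [Q [hM1 hQ hK1]]] : syz b.+1 I K1.
  by apply/syz_rcons; exists K, P.
apply: proj_split h hP (ext0_syz_cores (hb _ _) hK).
exact: IH hK1 hL hL'.
Qed.

End Dimension2.

Definition ginj (C : excat) (M : obj C) : Prop := @gproj (opcat C) M.

(** * Transfer of the results to the opposite category *)

Section Duality.
Variable C : excat.

(** The double opposite has the data of [C] but other proofs of the axioms, so the two are compared
    through [res] rather than identified. *)
Lemma op_res (G : obj C -> Prop) M n : @res (opcat (opcat C)) G M n <-> @res C G M n.
Proof.
elim: n M => [|n IH] M //=; split=> -[K [P [h hP hK]]]; exists K, P; split=> //;
  first [exact/IH | by apply/op_ex/op_ex].
Qed.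

Lemma op_silp n : @silp_le (opcat C) n <-> @spli_le C n.
Proof. by split=> h I hI; apply/op_res; apply: h. Qed.

(** Holds by conversion: the binders of [coext0] come in the order that [ext0] takes in
    [opcat C]. *)
Lemma op_spli n : @spli_le (opcat C) n <-> @silp_le C n.
Proof. by []. Qed.

Lemma gproj_finite n :
  (forall M : obj C, res (@gproj C) M n) <-> silp_le C n /\ spli_le C n.
Proof.
split=> [h|[h1 h2]]; last exact: res_gproj.
by split; [exact: gproj_silp|exact: gproj_spli].
Qed.

End Duality.

Lemma ginj_finite (C : excat) n :
  (forall M : obj C, cores (@ginj C) M n) <-> silp_le C n /\ spli_le C n.
Proof. by rewrite (@gproj_finite (opcat C)) op_silp op_spli and_comm. Qed.

Lemma spli_silp (C : excat) b m : spli_le C b -> silp_le C m -> silp_le C b.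
Proof. by move=> /op_silp; exact: (@silp_spli (opcat C)). Qed.

(** * The category of modules *)

Section LinearMaps.
Variable R : pzRingType.
Implicit Types U V W : lmodType R.

(** The category axioms are Leibniz equalities of bundled maps, hence the appeal to proof
    irrelevance. *)
Lemma linear_ext U V (f g : {linear U -> V}) : f =1 g -> f = g.
Proof.
case: f => f [[f0] [fZ]]; case: g => g [[g0] [gZ]] /= /funext fg.
by subst g; rewrite (Prop_irrelevance f0 g0) (Prop_irrelevance fZ gZ).
Qed.

Lemma ex_linear U V (f : U -> V) : linear f -> exists g : {linear U -> V}, g =1 f.
Proof.
move=> fL; pose m := GRing.isLinear.Build _ _ _ _ f fL.
by exists (HB.pack_for {linear U -> V} f m).
Qed.

Lemma linear_factor_inj U V W (i : {linear V -> W}) (f : {linear U -> W}) :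
  injective i -> (forall x, exists y, i y = f x) ->
  exists g : {linear U -> V}, forall x, i (g x) = f x.
Proof.
move=> hi /choice[g gE].
have [|g' g'E] := @ex_linear _ _ g.
  by move=> a x y; apply: hi; rewrite !(gE, linearP).
by exists g' => x; rewrite g'E.
Qed.

Lemma linear_factor_surj U V W (p : {linear V -> W}) (f : {linear V -> U}) :
  surjective_map p -> (forall x, p x = 0 -> f x = 0) ->
  exists g : {linear W -> U}, forall x, g (p x) = f x.
Proof.
move=> /choice[s sE] pf.
have fE x y : p x = p y -> f x = f y.
  move=> pxy; apply/eqP; rewrite -subr_eq0 -linearB; apply/eqP/pf.
  by rewrite linearB pxy subrr.
have [|g gE] := @ex_linear _ _ (f \o s).
  by move=> a x y /=; rewrite -linearP; apply: fE; rewrite !(sE, linearP).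
by exists g => x; rewrite gE; apply: fE; rewrite sE.
Qed.

Lemma linear_inj U V (f : {linear U -> V}) :
  (forall x, f x = 0 -> x = 0) -> injective f.
Proof.
by move=> h x y fxy; apply/eqP; rewrite -subr_eq0 (h (x - y)) // linearB fxy subrr.
Qed.

End LinearMaps.

Section Kernel.
Variables (R : pzRingType) (V W : lmodType R) (f : {linear V -> W}).

Definition ker_pred : {pred V} := fun x => f x == 0.

Lemma ker_submod_closed : submod_closed ker_pred.
Proof.
split=> [|a x y]; rewrite /ker_pred !unfold_in ?linear0 //.
by move=> /eqP fx /eqP fy; rewrite linearP fx fy scaler0 addr0.
Qed.
HB.instance Definition _ := GRing.isSubmodClosed.Build R V ker_pred ker_submod_closed.

Record kernel := Kernel {ker_val : V; _ : ker_val \in ker_pred}.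
HB.instance Definition _ := [isSub for ker_val].
HB.instance Definition _ := [Choice of kernel by <:].
HB.instance Definition _ := [SubChoice_isSubLmodule of kernel by <:].

Lemma ex_kernel :
  exists (K : lmodType R) (i : {linear K -> V}), injective i /\ exact_at i f.
Proof.
exists kernel, (\val : {linear kernel -> V}); split; first exact: val_inj.
move=> y; split=> [fy|[x <-]]; last exact/eqP/(valP x).
by have /eqP h := fy; exists (Kernel (h : y \in ker_pred)).
Qed.

End Kernel.

(* Modules whose operations are only defined, and whose axioms only hold, up to
   an equivalence relation. *)
Record prelmod (R : pzRingType) := Prelmod {
  pcar : choiceType;
  peq : pcar -> pcar -> Prop;
  pzero : pcar;
  padd : pcar -> pcar -> pcar;
  popp : pcar -> pcar;
  pscale : R -> pcar -> pcar;
  peq_refl : forall x, peq x x;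
  peq_sym : forall x y, peq x y -> peq y x;
  peq_trans : forall x y z, peq x y -> peq y z -> peq x z;
  padd_eq : forall x y z t, peq x y -> peq z t -> peq (padd x z) (padd y t);
  popp_eq : forall x y, peq x y -> peq (popp x) (popp y);
  pscale_eq : forall a x y, peq x y -> peq (pscale a x) (pscale a y);
  paddA : forall x y z, peq (padd x (padd y z)) (padd (padd x y) z);
  paddC : forall x y, peq (padd x y) (padd y x);
  padd0 : forall x, peq (padd pzero x) x;
  paddN : forall x, peq (padd (popp x) x) pzero;
  pscaleA : forall a b x, peq (pscale a (pscale b x)) (pscale (a * b) x);
  pscale1 : forall x, peq (pscale 1 x) x;
  pscaleDr : forall a x y,
    peq (pscale a (padd x y)) (padd (pscale a x) (pscale a y));
  pscaleDl : forall x a b,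
    peq (pscale (a + b) x) (padd (pscale a x) (pscale b x))
}.

(** * Quotient modules, used for cokernels, free modules and Q/Z *)

Section Quotient.
Variables (R : pzRingType) (T : prelmod R).
Implicit Types x y : pcar T.

Lemma peq_ex x : exists y, `[< peq x y >].
Proof. by exists x; apply/asboolP/peq_refl. Qed.

(** [xchoose] depends only on the extension of its predicate, so related elements get the same
    representative; the quotient is the subtype of these representatives. *)
Definition prepr x : pcar T := xchoose (peq_ex x).

Lemma preprP x : peq x (prepr x).
Proof. exact/asboolP/(xchooseP (peq_ex x)). Qed.

Lemma prepr_eq x y : peq x y -> prepr x = prepr y.
Proof.
move=> xy; apply: eq_xchoose => z; apply/asboolP/asboolP; apply: peq_trans => //.
exact: peq_sym.
Qed.

Lemma prepr_id x : prepr (prepr x) == prepr x.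
Proof. exact/eqP/esym/prepr_eq/preprP. Qed.

Record quot := Quot {quot_val : pcar T; _ : prepr quot_val == quot_val}.
HB.instance Definition _ := [isSub for quot_val].
HB.instance Definition _ := [Choice of quot by <:].

Definition qpi x : quot := Quot (prepr_id x).

Lemma qpi_eq x y : peq x y -> qpi x = qpi y.
Proof. by move=> xy; apply: val_inj; exact: prepr_eq. Qed.

Lemma peq_qpi x y : qpi x = qpi y -> peq x y.
Proof.
by move=> [xy]; apply: peq_trans (preprP x) _; rewrite xy; apply/peq_sym/preprP.
Qed.

Lemma qpi_val (u : quot) : qpi (quot_val u) = u.
Proof. by apply: val_inj; case: u => u /= /eqP. Qed.

Definition qadd (u v : quot) := qpi (padd (quot_val u) (quot_val v)).
Definition qopp (u : quot) := qpi (popp (quot_val u)).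
Definition qscale a (u : quot) := qpi (pscale a (quot_val u)).

Lemma qpi_valE x : peq (quot_val (qpi x)) x.
Proof. exact/peq_sym/preprP. Qed.

Lemma qpiD x y : qpi (padd x y) = qadd (qpi x) (qpi y).
Proof. by apply/qpi_eq/padd_eq; apply/peq_sym/qpi_valE. Qed.

Lemma qpiN x : qpi (popp x) = qopp (qpi x).
Proof. by apply/qpi_eq/popp_eq/peq_sym/qpi_valE. Qed.

Lemma qpiZ a x : qpi (pscale a x) = qscale a (qpi x).
Proof. by apply/qpi_eq/pscale_eq/peq_sym/qpi_valE. Qed.

Lemma quot_surj (u : quot) : exists x, qpi x = u.
Proof. by exists (quot_val u); exact: qpi_val. Qed.

Fact qaddA : associative qadd.
Proof.
move=> u v w; have [x <-] := quot_surj u; have [y <-] := quot_surj v.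
by have [z <-] := quot_surj w; rewrite -!qpiD; apply/qpi_eq/paddA.
Qed.

Fact qaddC : commutative qadd.
Proof.
move=> u v; have [x <-] := quot_surj u; have [y <-] := quot_surj v.
by rewrite -!qpiD; apply/qpi_eq/paddC.
Qed.

Fact qadd0 : left_id (qpi (pzero T)) qadd.
Proof.
by move=> u; have [x <-] := quot_surj u; rewrite -qpiD; apply/qpi_eq/padd0.
Qed.

Fact qaddN : left_inverse (qpi (pzero T)) qopp qadd.
Proof.
move=> u; have [x <-] := quot_surj u.
by rewrite -qpiN -qpiD; apply/qpi_eq/paddN.
Qed.

HB.instance Definition _ := GRing.isZmodule.Build quot qaddA qaddC qadd0 qaddN.

Fact qscaleA a b u : qscale a (qscale b u) = qscale (a * b) u.
Proof.
by have [x <-] := quot_surj u; rewrite -!qpiZ; apply/qpi_eq/pscaleA.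
Qed.

Fact qscale1 : left_id 1 qscale.
Proof.
by move=> u; have [x <-] := quot_surj u; rewrite -qpiZ; apply/qpi_eq/pscale1.
Qed.

Fact qscaleDr : right_distributive qscale qadd.
Proof.
move=> a u v; have [x <-] := quot_surj u; have [y <-] := quot_surj v.
by rewrite -qpiD -!qpiZ -qpiD; apply/qpi_eq/pscaleDr.
Qed.

Fact qscaleDl u : {morph qscale^~ u : a b / a + b >-> qadd a b}.
Proof.
move=> a b; have [x <-] := quot_surj u.
by rewrite -!qpiZ -qpiD; apply/qpi_eq/pscaleDl.
Qed.

HB.instance Definition _ :=
  GRing.Zmodule_isLmodule.Build R quot qscaleA qscale1 qscaleDr qscaleDl.

Lemma ex_quot : exists (Q : lmodType R) (p : pcar T -> Q),
  [/\ surjective_map p, forall x y, p x = p y <-> peq x y,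
      forall x y, p (padd x y) = p x + p y
    & forall a x, p (pscale a x) = a *: p x].
Proof.
exists quot, qpi; split; [exact: quot_surj| |exact: qpiD|exact: qpiZ].
by move=> x y; split; [exact: peq_qpi|exact: qpi_eq].
Qed.

End Quotient.

Section Cokernel.
Variables (R : pzRingType) (U V : lmodType R) (f : {linear U -> V}).

Lemma ex_cokernel :
  exists (Q : lmodType R) (p : {linear V -> Q}), surjective_map p /\ exact_at f p.
Proof.
pose e (x y : V) := exists u, f u = x - y.
have e0 x y : x = y -> e x y by move=> ->; exists 0; rewrite linear0 subrr.
have es x y : e x y -> e y x.
  by move=> [u uE]; exists (- u); rewrite linearN uE opprB.
have et x y z : e x y -> e y z -> e x z.
  move=> [u uE] [v vE]; exists (u + v).
  by rewrite linearD uE vE addrA subrK.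
have ea x y z t : e x y -> e z t -> e (x + z) (y + t).
  move=> [u uE] [v vE]; exists (u + v).
  by rewrite linearD uE vE opprD addrACA.
have en x y : e x y -> e (- x) (- y).
  by move=> [u uE]; exists (- u); rewrite linearN uE opprB opprK addrC.
have ez a x y : e x y -> e (a *: x) (a *: y).
  by move=> [u uE]; exists (a *: u); rewrite linearZ uE /= scalerBr.
have [Q [p [hs pe pD pZ]]] := ex_quot (@Prelmod R V e 0 +%R -%R *:%R
  (fun x => e0 _ _ (erefl x)) es et ea en ez
  (fun x y z => e0 _ _ (addrA x y z)) (fun x y => e0 _ _ (addrC x y))
  (fun x => e0 _ _ (add0r x)) (fun x => e0 _ _ (addNr x))
  (fun a b x => e0 _ _ (scalerA a b x)) (fun x => e0 _ _ (scale1r x))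
  (fun a x y => e0 _ _ (scalerDr a x y)) (fun x a b => e0 _ _ (scalerDl x a b))).
have [|q qE] := @ex_linear _ _ _ p; first by move=> a x y; rewrite -pZ -pD.
exists Q, q; split; first by move=> y; have [x <-] := hs y; exists x.
move=> y; rewrite qE -(linear0 q) qE pe /e.
by split=> -[x xE]; exists x; rewrite ?xE ?subr0 // -[RHS]subr0.
Qed.

End Cokernel.

(** * Short exact sequences of modules, with the pullback and pushout axioms *)

Section ShortExact.
Variable R : pzRingType.
Implicit Types A B D K L M P U V X : lmodType R.

Definition lid A : {linear A -> A} := idfun.
Definition lcomp A B D (g : {linear B -> D}) (f : {linear A -> B}) :
  {linear A -> D} := g \o f.
Definition lzero A B : {linear A -> B} := \0.
Definition lsub A B (f g : {linear A -> B}) : {linear A -> B} := f \- g.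

Definition mses A B D (i : {linear A -> B}) (p : {linear B -> D}) : Prop :=
  [/\ injective i, surjective_map p & exact_at i p].

Lemma mses_comp0 A B D (i : {linear A -> B}) (p : {linear B -> D}) :
  mses i p -> forall x, p (i x) = 0.
Proof. by move=> [_ _ e] x; apply/e; exists x. Qed.

Lemma mses_ker A B D (i : {linear A -> B}) (p : {linear B -> D}) X
    (f : {linear X -> B}) :
  mses i p -> (forall x, p (f x) = 0) ->
  exists g : {linear X -> A}, forall x, i (g x) = f x.
Proof.
by move=> [hi _ e] pf; apply: linear_factor_inj => // x; apply/e/pf.
Qed.

Lemma mses_coker A B D (i : {linear A -> B}) (p : {linear B -> D}) X
    (f : {linear B -> X}) :
  mses i p -> (forall x, f (i x) = 0) ->
  exists g : {linear D -> X}, forall x, g (p x) = f x.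
Proof.
move=> [_ hp e] fi; apply: linear_factor_surj => // x /e[y <-]; exact: fi.
Qed.

Lemma mses_surj A B (p : {linear A -> B}) :
  surjective_map p -> exists (K : lmodType R) (i : {linear K -> A}), mses i p.
Proof.
by move=> hp; have [K [i [hi e]]] := ex_kernel p; exists K, i; split.
Qed.

Lemma mses_inj A B (i : {linear A -> B}) :
  injective i -> exists (Q : lmodType R) (p : {linear B -> Q}), mses i p.
Proof.
by move=> hi; have [Q [p [hp e]]] := ex_cokernel i; exists Q, p; split.
Qed.

Lemma mses_flip A B D (i : {linear A -> B}) (p : {linear B -> D})
    (r : {linear B -> A}) (s : {linear D -> B}) :
  mses i p -> lcomp r i = lid A -> lcomp p s = lid D -> lcomp r s = lzero D A ->
  mses s r.
Proof.
move=> hip ri ps rs.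
have {}ri x : r (i x) = x by have := congr1 (fun f : {linear A -> A} => f x) ri.
have {}ps x : p (s x) = x by have := congr1 (fun f : {linear D -> D} => f x) ps.
have {}rs x : r (s x) = 0 by have := congr1 (fun f : {linear D -> A} => f x) rs.
split; [exact: can_inj ps|by move=> y; exists (i y)|move=> y].
split=> [ry|[x <-] //]; exists (p y); case: hip => _ _ e.
have [|x xE] := (e (y - s (p y))).1; first by rewrite linearB ps subrr.
apply/eqP; rewrite eq_sym -subr_eq0 -xE.
by rewrite -(ri x) xE linearB ry rs subrr linear0.
Qed.

(** [L] is the preimage of [A] in [P], obtained as the kernel of the composite onto [M]. *)
Lemma mses_pullback_mono K P D A M (i : {linear K -> P}) (p : {linear P -> D})
    (j : {linear A -> D}) (q : {linear D -> M}) :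
  mses i p -> mses j q -> exists L : lmodType R,
    (exists (k : {linear L -> P}) (l : {linear P -> M}), mses k l) /\
    (exists (k : {linear K -> L}) (l : {linear L -> A}), mses k l).
Proof.
move=> hip hjq; have [hi hp e] := hip; have [hj hq e'] := hjq.
have [|L [k hk]] := @mses_surj _ _ (lcomp q p).
  by move=> y; have [x <-] := hq y; have [z <-] := hp x; exists z.
have [hki _ hke] := hk.
have [|k' k'E] := @mses_ker _ _ _ _ _ _ i hk.
  by move=> x /=; rewrite (mses_comp0 hip) linear0.
have [|l lE] := @mses_ker _ _ _ _ _ _ (lcomp p k) hjq.
  by move=> x /=; exact: (mses_comp0 hk).
exists L; split; first by exists k, (lcomp q p).
exists k', l; split.
- by move=> x y xy; apply: hi; rewrite -!k'E xy.
- move=> a; have [z zE] := hp (j a).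
  have [|x xE] := (hke z).1; first by rewrite /= zE (mses_comp0 hjq).
  by exists x; apply: hj; rewrite lE /= xE zE.
- move=> y; split=> [ly|[x <-]]; last first.
    by apply: hj; rewrite lE /= k'E (mses_comp0 hip) linear0.
  have [|x xE] := (e (k y)).1; first by have /= <- := lE y; rewrite ly linear0.
  by exists x; apply: hki; rewrite k'E.
Qed.

(** [L] is the quotient of [P] by the image of [M]. *)
Lemma mses_pushout_epi K P D A M (i : {linear P -> K}) (p : {linear D -> P})
    (j : {linear D -> A}) (q : {linear M -> D}) :
  mses p i -> mses q j -> exists L : lmodType R,
    (exists (k : {linear P -> L}) (l : {linear M -> P}), mses l k) /\
    (exists (k : {linear L -> K}) (l : {linear A -> L}), mses l k).
Proof.
move=> hpi hqj; have [hp hi e] := hpi; have [hq hj e'] := hqj.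
have [|L [k hk]] := @mses_inj _ _ (lcomp p q).
  by move=> x y /= /hp/hq.
have [_ hks hke] := hk.
have [|k' k'E] := @mses_coker _ _ _ _ _ _ i hk.
  by move=> x /=; exact: (mses_comp0 hpi).
have [|l lE] := @mses_coker _ _ _ _ _ _ (lcomp k p) hqj.
  by move=> x /=; exact: (mses_comp0 hk).
exists L; split; first by exists k, (lcomp p q).
exists k', l; split.
- apply: linear_inj => a; have [d <-] := hj a; rewrite lE /= => /hke[m mE].
  by rewrite -(hp _ _ mE) (mses_comp0 hqj).
- by move=> y; have [x <-] := hi y; exists (k x); rewrite k'E.
- move=> y; split=> [|[a <-]].
    have [x <-] := hks y; rewrite k'E => /e[d dE].
    by exists (j d); rewrite lE /= dE.
  by have [d <-] := hj a; rewrite lE /= k'E (mses_comp0 hpi).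
Qed.

(** [Y] is the fibre product of [B] and [X] over [D], the kernel of the difference map [f]. *)
Lemma mses_pullback_epi A B D K X (i : {linear A -> B}) (p : {linear B -> D})
    (j : {linear K -> X}) (q : {linear X -> D}) :
  mses i p -> mses j q -> exists Y : lmodType R,
    (exists (k : {linear A -> Y}) (l : {linear Y -> X}), mses k l) /\
    (exists (k : {linear K -> Y}) (l : {linear Y -> B}), mses k l).
Proof.
move=> hip hjq; have [hi hp e] := hip; have [hj hq e'] := hjq.
have [f fE] : exists f : {linear (B * X)%type -> D}, forall u, f u = p u.1 - q u.2.
  have [|f fE] := @ex_linear _ _ _ (fun u : B * X => p u.1 - q u.2).
    by move=> a u v; rewrite /= !linearP scalerDr addrACA.
  by exists f.
have [Y [k [hk ke]]] := ex_kernel f.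
have kE y : p (k y).1 = q (k y).2.
  by apply/eqP; rewrite -subr_eq0 -fE; apply/eqP/ke; exists y.
have [a aE] : exists a : {linear A -> (B * X)%type}, forall x, a x = (i x, 0).
  have [|a aE] := @ex_linear _ _ _ (fun x : A => (i x, 0) : (B * X)%type).
    by move=> c x y; rewrite linearP; congr pair; rewrite /= scaler0 addr0.
  by exists a.
have [b bE] : exists b : {linear K -> (B * X)%type}, forall x, b x = (0, j x).
  have [|b bE] := @ex_linear _ _ _ (fun x : K => (0, j x) : (B * X)%type).
    by move=> c x y; rewrite linearP; congr pair; rewrite /= scaler0 addr0.
  by exists b.
have [|a' a'E] := @linear_factor_inj _ _ _ _ k a hk.
  by move=> x; apply/ke; rewrite fE aE /= linear0 (mses_comp0 hip) subrr.
have [|b' b'E] := @linear_factor_inj _ _ _ _ k b hk.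
  by move=> x; apply/ke; rewrite fE bE /= linear0 (mses_comp0 hjq) subrr.
have [l1 l1E] : exists l : {linear Y -> B}, forall y, l y = (k y).1.
  by apply: ex_linear => c x y; rewrite linearP.
have [l2 l2E] : exists l : {linear Y -> X}, forall y, l y = (k y).2.
  by apply: ex_linear => c x y; rewrite linearP.
exists Y; split; [exists a', l2|exists b', l1]; split.
- by move=> x y xy; apply: hi; have := a'E y; rewrite -xy a'E !aE => -[].
- move=> x; have [z zE] := hp (q x).
  by have [|y yE] := (ke (z, x)).1; [rewrite fE zE subrr|exists y; rewrite l2E yE].
- move=> y; split=> [|[x <-]]; last by rewrite l2E a'E aE.
  rewrite l2E => y2; have [|x xE] := (e (k y).1).1; first by rewrite kE y2 linear0.
  by exists x; apply: hk; rewrite a'E aE xE -y2 -surjective_pairing.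
- by move=> x y xy; apply: hj; have := b'E y; rewrite -xy b'E !bE => -[].
- move=> x; have [z zE] := hq (p x).
  by have [|y yE] := (ke (x, z)).1; [rewrite fE zE subrr|exists y; rewrite l1E yE].
- move=> y; split=> [|[x <-]]; last by rewrite l1E b'E bE.
  rewrite l1E => y1; have [|x xE] := (e' (k y).2).1; first by rewrite -kE y1 linear0.
  by exists x; apply: hk; rewrite b'E bE xE -y1 -surjective_pairing.
Qed.

(** [Y] is the quotient of the product of [B] and [X] by the pairs (p x, q x). With this sign the
    square commutes up to sign only, and the two exact sequences are unaffected. *)
Lemma mses_pushout_mono A B D K X (i : {linear B -> A}) (p : {linear D -> B})
    (j : {linear X -> K}) (q : {linear D -> X}) :
  mses p i -> mses q j -> exists Y : lmodType R,
    (exists (k : {linear Y -> A}) (l : {linear X -> Y}), mses l k) /\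
    (exists (k : {linear Y -> K}) (l : {linear B -> Y}), mses l k).
Proof.
move=> hpi hqj; have [hp hi e] := hpi; have [hq hj e'] := hqj.
have [f fE] : exists f : {linear D -> (B * X)%type}, forall x, f x = (p x, q x).
  have [|f fE] := @ex_linear _ _ _ (fun x : D => (p x, q x) : (B * X)%type).
    by move=> a u v; rewrite !linearP.
  by exists f.
have [Y [k [hk ke]]] := ex_cokernel f.
have [a aE] : exists a : {linear (B * X)%type -> A}, forall x, a x = i x.1.
  have [|a aE] := @ex_linear _ _ _ (fun x : B * X => i x.1).
    by move=> c x y; rewrite linearP.
  by exists a.
have [b bE] : exists b : {linear (B * X)%type -> K}, forall x, b x = j x.2.
  have [|b bE] := @ex_linear _ _ _ (fun x : B * X => j x.2).
    by move=> c x y; rewrite linearP.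
  by exists b.
have [|a' a'E] := @linear_factor_surj _ _ _ _ k a hk.
  by move=> u /ke[x <-]; rewrite fE aE (mses_comp0 hpi).
have [|b' b'E] := @linear_factor_surj _ _ _ _ k b hk.
  by move=> u /ke[x <-]; rewrite fE bE (mses_comp0 hqj).
have [l1 l1E] : exists l : {linear B -> Y}, forall y, l y = k (y, 0).
  apply: ex_linear => c x y; rewrite -linearP; congr (k _); congr pair.
  by rewrite /= scaler0 addr0.
have [l2 l2E] : exists l : {linear X -> Y}, forall y, l y = k (0, y).
  apply: ex_linear => c x y; rewrite -linearP; congr (k _); congr pair.
  by rewrite /= scaler0 addr0.
exists Y; split; [exists a', l2|exists b', l1]; split.
- apply: linear_inj => x; rewrite l2E => /ke[d]; rewrite fE => -[d0 <-].
  by rewrite (_ : d = 0) ?linear0 //; apply: hp; rewrite linear0.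
- by move=> x; have [y <-] := hi x; exists (k (y, 0)); rewrite a'E aE.
- move=> y; split=> [|[x <-]]; last by rewrite l2E a'E aE linear0.
  have [[u v] <-] := hk y; rewrite a'E aE /= => /e[d dE].
  exists (v - q d); rewrite l2E; apply/eqP; rewrite -subr_eq0 -linearB.
  apply/eqP/ke; exists (- d); rewrite fE !linearN dE.
  by congr pair; rewrite /= ?sub0r // addrAC subrr sub0r.
- apply: linear_inj => x; rewrite l1E => /ke[d]; rewrite fE => -[<- d0].
  by rewrite (_ : d = 0) ?linear0 //; apply: hq; rewrite linear0.
- by move=> x; have [y <-] := hj x; exists (k (0, y)); rewrite b'E bE.
- move=> y; split=> [|[x <-]]; last by rewrite l1E b'E bE linear0.
  have [[u v] <-] := hk y; rewrite b'E bE /= => /e'[d dE].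
  exists (u - p d); rewrite l1E; apply/eqP; rewrite -subr_eq0 -linearB.
  apply/eqP/ke; exists (- d); rewrite fE !linearN dE.
  by congr pair; rewrite /= ?sub0r // addrAC subrr sub0r.
Qed.

Definition zero_module : lmodType R := kernel (lid R^o).

Lemma zero_module0 (x : zero_module) : x = 0.
Proof. by apply: val_inj; apply/eqP; exact: (valP x). Qed.

End ShortExact.

(** * Free modules and enough projectives *)

Section Free.
Variable R : pzRingType.

Definition feval (X : Type) (N : lmodType R) (g : X -> N) (s : seq (R * X)) : N :=
  \sum_(u <- s) u.1 *: g u.2.

Lemma feval_cat X (N : lmodType R) (g : X -> N) s t :
  feval g (s ++ t) = feval g s + feval g t.
Proof. exact: big_cat. Qed.

Lemma feval_scale X (N : lmodType R) (g : X -> N) a s :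
  feval g [seq (a * u.1, u.2) | u <- s] = a *: feval g s.
Proof.
rewrite /feval big_map scaler_sumr; apply: eq_bigr => u _.
by rewrite /= scalerA.
Qed.

(* The free module on X: two formal linear combinations are identified when they
   have the same value under every map from X to a module. *)
Lemma ex_free (X : choiceType) : exists (P : lmodType R) (b : X -> P),
  forall (N : lmodType R) (g : X -> N),
    exists2 h : {linear P -> N}, forall x, h (b x) = g x &
      forall (h' : {linear P -> N}), (forall x, h' (b x) = g x) -> h' =1 h.
Proof.
pose e (s t : seq (R * X)) := forall (N : lmodType R) (g : X -> N),
  feval g s = feval g t.
pose sc a (s : seq (R * X)) := [seq (a * u.1, u.2) | u <- s].
have fD := (feval_cat, feval_scale).
have e1 s : e s s by [].
have e2 s t : e s t -> e t s by move=> h N g; rewrite h.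
have e3 s t v : e s t -> e t v -> e s v by move=> h h' N g; rewrite h h'.
have e4 s t v w : e s t -> e v w -> e (s ++ v) (t ++ w).
  by move=> h h' N g; rewrite !fD h h'.
have e6 a s t : e s t -> e (sc a s) (sc a t) by move=> h N g; rewrite !fD h.
have e7 s t v : e (s ++ (t ++ v)) ((s ++ t) ++ v) by move=> N g; rewrite catA.
have e8 s t : e (s ++ t) (t ++ s) by move=> N g; rewrite !fD addrC.
have e9 s : e (sc (- 1) s ++ s) [::].
  by move=> N g; rewrite !fD scaleN1r addNr /feval big_nil.
have e10 a b s : e (sc a (sc b s)) (sc (a * b) s).
  by move=> N g; rewrite !fD scalerA.
have e11 s : e (sc 1 s) s by move=> N g; rewrite !fD scale1r.
have e12 a s t : e (sc a (s ++ t)) (sc a s ++ sc a t).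
  by move=> N g; rewrite !fD scalerDr.
have e13 s a b : e (sc (a + b) s) (sc a s ++ sc b s).
  by move=> N g; rewrite !fD scalerDl.
have [P [p [ps pe pD pZ]]] := ex_quot (@Prelmod R _ e [::] cat (sc (- 1)) sc
  e1 e2 e3 e4 (e6 _) e6 e7 e8 e1 e9 e10 e11 e12 e13).
have {}pD s t : p (s ++ t) = p s + p t := pD s t.
have {}pZ a s : p (sc a s) = a *: p s := pZ a s.
exists P, (fun x => p [:: (1, x)]) => N g.
have [s sK] := choice ps.
have hE t : feval g (s (p t)) = feval g t by have /pe := sK (p t); apply.
have [|h hh] := @ex_linear _ _ _ (fun u => feval g (s u)).
  move=> a u v; have [x <-] := ps u; have [y <-] := ps v.
  by rewrite -pZ -pD !hE /= !fD.
have hb x : h (p [:: (1, x)]) = g x by rewrite hh hE /feval big_seq1 scale1r.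
exists h => // h' h'b u; have [t <-] := ps u; elim: t => [|[a x] t IH].
  have p0 : p [::] = 0.
    by apply: (addrI (p [::])); rewrite -pD addr0.
  by rewrite p0 !linear0.
have -> : (a, x) :: t = sc a [:: (1, x)] ++ t by rewrite /sc /= mulr1.
by rewrite pD pZ !linearD !linearZ IH h'b hb.
Qed.

Lemma ex_projective_surjection (M : lmodType R) :
  exists (P : lmodType R) (p : {linear P -> M}),
    projective_module P /\ surjective_map p.
Proof.
have [P [b hP]] := ex_free M; have [p pE _] := hP M id.
exists P, p; split; last by move=> x; exists (b x).
move=> A B g f /choice[s sE].
have [h hE _] := hP A (fun x => s (f (b x))).
have [k _ kU] := hP B (f \o b).
exists h => x; rewrite (kU f) // -(kU (lcomp g h)) // => y.
by rewrite /= hE sE.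
Qed.

End Free.

(** * Subgroups of the integers and the divisible group Q/Z *)

Section DivisibleGroup.

Lemma int_subgroup (J : int -> Prop) : J 0 -> (forall k l, J k -> J l -> J (k - l)) ->
  exists2 n : nat, J n & forall k, J k -> exists q, k = q * n%:Z.
Proof.
move=> J0 JB.
have JN k : J k -> J (- k) by move=> Jk; rewrite -[- k]sub0r; apply: JB.
have Ja k : J k -> J `|k|%N.
  by case: k => n Jk //; have := JN _ Jk; rewrite NegzE opprK.
have Jm (n : nat) q : J n -> J (q * n%:Z).
  move=> Jn; suff Jq (r : nat) : J (r%:Z * n%:Z).
    by case: q => r; [exact: Jq|rewrite NegzE mulNr; apply/JN/Jq].
  elim: r => [|r IH]; first by rewrite mul0r.
  by rewrite intS mulrDl mul1r -[X in X + _]opprK addrC; apply: JB => //; apply: JN.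
(* The generator is the least positive element of [J], or 0 when there is none. *)
have [[n /andP[n0 /asboolP Jn]]|noJ] :=
    pselect (exists n : nat, (0 < n)%N && `[< J n >]).
  have Jex : exists n : nat, (0 < n)%N && `[< J n >].
    by exists n; rewrite n0; apply/asboolP.
  have [m /andP[m0 /asboolP Jm0] mmin] := ex_minnP Jex.
  exists m => // k Jk; exists (k %/ m)%Z.
  have := JB _ _ Jk (Jm _ (k %/ m)%Z Jm0); rewrite {1}(divz_eq k m) addrAC subrr add0r.
  have m0' : (m%:Z != 0) by rewrite eqz_nat -lt0n.
  have r0 := modz_ge0 k m0'.
  move=> Jr; rewrite {1}(divz_eq k m).
  case: (eqVneq (k %% m)%Z 0) => [->|rn0]; first by rewrite addr0.
  have rm : (k %% m)%Z < m by apply: ltz_pmod.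
  have := mmin `|(k %% m)%Z|%N; rewrite absz_gt0 rn0 /=.
  move/(_ (introT (asboolP _) (Ja _ Jr))).
  by rewrite -lez_nat gez0_abs // leNgt rm.
exists 0%N => // k Jk; exists 0; rewrite mul0r.
apply/eqP/negPn/negP => k0; apply: noJ; exists `|k|%N.
by rewrite absz_gt0 k0 /=; apply/asboolP/Ja.
Qed.

(** Q/Z as a quotient of [rat] over [int]. The second property provides a nonzero image for an
    element of order [n], where [n = 0] stands for infinite order. *)
Lemma ex_QmodZ : exists D : zmodType,
  (forall (n : nat) (d : D), (0 < n)%N -> exists d', d' *+ n = d) /\
  (forall n : nat, n != 1%N -> exists2 d : D, d != 0 & d *+ n = 0).
Proof.
pose e (x y : rat) := exists n : int, x - y = n%:~R.
have e0 x y : x = y -> e x y by move=> ->; exists 0; rewrite subrr.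
have es x y : e x y -> e y x by move=> [n nE]; exists (- n); rewrite rmorphN /= -nE opprB.
have et x y z : e x y -> e y z -> e x z.
  by move=> [n nE] [m mE]; exists (n + m); rewrite rmorphD /= -nE -mE addrA subrK.
have ea x y z t : e x y -> e z t -> e (x + z) (y + t).
  by move=> [n nE] [m mE]; exists (n + m); rewrite rmorphD /= -nE -mE opprD addrACA.
have en x y : e x y -> e (- x) (- y).
  by move=> [n nE]; exists (- n); rewrite rmorphN /= -nE opprB opprK addrC.
have ez (a : int) x y : e x y -> e (a%:~R * x) (a%:~R * y).
  by move=> [n nE]; exists (a * n); rewrite rmorphM /= -nE mulrBr.
have eA (a b : int) x : e (a%:~R * (b%:~R * x)) ((a * b)%:~R * x).
  by apply: e0; rewrite rmorphM mulrA.
have e1 x : e (1%:~R * x) x by apply: e0; rewrite mul1r.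
have eDr (a : int) x y : e (a%:~R * (x + y)) (a%:~R * x + a%:~R * y).
  by apply: e0; rewrite mulrDr.
have eDl x (a b : int) : e ((a + b)%:~R * x) (a%:~R * x + b%:~R * x).
  by apply: e0; rewrite rmorphD mulrDl.
have [D [p [ps pe pD pZ]]] := ex_quot (@Prelmod int rat e 0 +%R -%R
  (fun a x => a%:~R * x) (fun x => e0 _ _ (erefl x)) es et ea en ez
  (fun x y z => e0 _ _ (addrA x y z)) (fun x y => e0 _ _ (addrC x y))
  (fun x => e0 _ _ (add0r x)) (fun x => e0 _ _ (addNr x)) eA e1 eDr eDl).
have {}pD x y : p (x + y) = p x + p y := pD x y.
have p0 : p 0 = 0 by apply: (addrI (p 0)); rewrite -pD !addr0.
have pM x n : p x *+ n = p (x *+ n).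
  by elim: n => [|n IH]; rewrite ?mulr0n ?p0 // !mulrS IH -pD.
exists D; split=> [n d n0|n n1].
  have [q <-] := ps d; exists (p (q / n%:R)).
  by rewrite pM -(mulr_natr (q / _)) divfK // pnatr_eq0 -lt0n.
case: n n1 => [|[//|n]] _.
  (* For [n = 0] any nonzero element serves; 1/2 is not an integer, by parity. For [n] at least 2
     the class of 1/n is used. *)
  exists (p 2^-1) => //; apply/eqP; rewrite -p0 => /pe[m].
  rewrite subr0 => mE; have : (2 * m)%:~R = 1 :> rat by rewrite rmorphM /= -mE divff.
  by move=> /(@intr_inj rat _ 1) /(congr1 (fun k => odd `|k|%N)); rewrite abszM oddM.
exists (p n.+2%:R^-1); last first.
  rewrite pM -(mulr_natr _^-1) mulVf ?pnatr_eq0 // -p0; apply/pe; exists 1.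
  by rewrite subr0.
apply/eqP; rewrite -p0 => /pe[m]; rewrite subr0 => mE.
have : (n.+2%:Z * m)%:~R = 1 :> rat by rewrite rmorphM /= -mE divff // pnatr_eq0.
move=> /(@intr_inj rat _ 1) /(congr1 (fun k => `|k|%N)); rewrite abszM => /eqP.
by rewrite muln_eq1.
Qed.

End DivisibleGroup.

(** * Extension of homomorphisms into a divisible group *)

Section Divisible.
Variable D : zmodType.
Hypothesis divisible : forall (n : nat) (d : D), (0 < n)%N -> exists d', d' *+ n = d.
Hypothesis torsion : forall n : nat, n != 1%N -> exists2 d : D, d != 0 & d *+ n = 0.
Variable A : zmodType.
Local Open Scope classical_set_scope.
Implicit Types (G H : set (A * D)).

(* [G] is the graph of a homomorphism from a subgroup of [A] to [D]. *)
Definition partial_hom G : Prop :=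
  [/\ G (0, 0), forall x y a b, G (x, a) -> G (y, b) -> G (x - y, a - b)
    & forall a, G (0, a) -> a = 0].

(** Adjoins [x] to the domain with value [a]; the second hypothesis says that [a] agrees with [G] on
    the multiples of [x] already in the domain. *)
Lemma partial_hom_extend G x a : partial_hom G ->
  (forall k b, G (x *~ k, b) -> a *~ k = b) ->
  partial_hom [set u | exists k : int, G (u.1 - x *~ k, u.2 - a *~ k)].
Proof.
move=> [G0 GB Gf] Gx; split=> [|y z b c [k hk] [l hl]|b [k]] /=.
- by exists 0; rewrite !mulr0z !subr0.
- have E (V : zmodType) (s t v w : V) : s - t - (v - w) = (s - v) - (t - w).
    by rewrite opprD [in RHS]opprD addrACA.
  by exists (k - l); rewrite /= !mulrzBr (E _ y) (E _ b); apply: GB.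
rewrite sub0r => hk; have := GB _ _ _ _ G0 hk; rewrite !sub0r opprK => /Gx.
by rewrite opprB => /eqP; rewrite -subr_eq0 opprB addrC subrK => /eqP.
Qed.

Lemma partial_hom_extension G : partial_hom G ->
  exists h : A -> D, zmod_morphism h /\ forall x a, G (x, a) -> h x = a.
Proof.
move=> hG.
(* Ordering the sets [H] by what they add to [G] also covers the empty chain, whose union is
   empty. *)
have [F FP totF|H0 [hH0 maxH]] := @Zorn_bigcup _ [set H | partial_hom (G `|` H)].
  have [G0 GB Gf] := hG.
  split=> [|x y a b|a]; first by left.
    have FB X : F X -> (G `|` X) (x, a) -> (G `|` X) (y, b) ->
        (G `|` \bigcup_(X in F) X) (x - y, a - b).
      move=> FX hx hy; have [_ XB _] := FP _ FX.
      by have [h|h] := XB _ _ _ _ hx hy; [left|right; exists X].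
    move=> [Gx|[X FX Xx]] [Gy|[Y FY Yy]].
    - by left; apply: GB.
    - by apply: (FB Y) => //; [left|right].
    - by apply: (FB X) => //; [right|left].
    - have [XY|YX] := totF _ _ FX FY.
        by apply: (FB Y) => //; right => //; apply: XY.
      by apply: (FB X) => //; right => //; apply: YX.
  move=> [/Gf//|[X FX Xa]]; have [_ _ Xf] := FP _ FX.
  by apply: Xf; right.
set H := G `|` H0 in hH0; have [H0' HB Hf] := hH0.
have total x : exists a, H (x, a).
  have [|k l [a ha] [b hb]|n [d0 hd0] hn] :=
      @int_subgroup (fun k => exists b, H (x *~ k, b)).
  - by exists 0; rewrite mulr0z.
  - by exists (a - b); rewrite mulrzBr; apply: HB.
  have [d dE] : exists d, d *+ n = d0.
    (* If only the multiple 0 of [x] lies in the domain, then [d0 = 0] and the value 0 will do. *)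
    case: n hd0 {hn} => [|n] hd0; last exact: divisible.
    by exists 0; rewrite mulr0n (Hf d0) // -(mulr0z x).
  (* Compatibility: if [k] times [x] is in the domain then [k] is [q] times [n], and [H] takes there
     the value [q] times [d0], that is [k] times [d]. *)
  have [k b hb|] := @partial_hom_extend H x d hH0.
    have [q kE] := hn _ (ex_intro _ b hb).
    have hq (r : nat) : H (x *~ (n%:Z * r%:Z), d0 *+ r).
      elim: r => [|r IH]; first by rewrite mulr0 mulr0z mulr0n.
      have /HB/(_ IH) := H0'.
      rewrite !sub0r => /(HB _ _ _ _ hd0); rewrite !opprK -mulrS.
      by rewrite intS mulrDr mulr1 mulrzDr.
    have {}hq : H (x *~ k, d0 *~ q).
      rewrite kE mulrC; case: q {kE} => r; first exact: hq.
      have := HB _ _ _ _ H0' (hq r.+1); rewrite !sub0r.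
      by rewrite NegzE mulrN !mulrNz.
    rewrite kE mulrC mulrzA -[d *~ n]/(d *+ n) dE.
    have := HB _ _ _ _ hq hb; rewrite subrr => /Hf /eqP.
    by rewrite subr_eq0 => /eqP.
  set H1 := [set u | _] => hH1.
  have HH1 : H `<=` H1 by move=> [y b] hy; exists 0; rewrite /= !mulr0z !subr0.
  (* Were (x, d) outside [H], the extension [H1] would contradict maximality. *)
  exists d; apply: contrapT => nHx; apply: (maxH H1).
    split=> [u hu|h]; first by apply: HH1; right.
    by apply: nHx; right; apply: h; exists 1; rewrite /= !mulr1z !subrr.
  rewrite /= (_ : G `|` H1 = H1) //; apply/setUidPr => u hu.
  by apply: HH1; left.
have [h hE] := choice total.
have Hu x a b : H (x, a) -> H (x, b) -> a = b.
  move=> ha hb; have := HB _ _ _ _ ha hb; rewrite subrr => /Hf/eqP.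
  by rewrite subr_eq0 => /eqP.
exists h; split=> [x y|x a Gx]; last exact: Hu (hE x) (or_introl Gx).
exact: Hu (hE _) (HB _ _ _ _ (hE x) (hE y)).
Qed.

(** Send [x] to a nonzero element killed by the order of [x], starting from the trivial partial
    homomorphism, and extend to all of [A]. *)
Lemma separating_hom (x : A) : x != 0 ->
  exists h : A -> D, zmod_morphism h /\ h x != 0.
Proof.
move=> x0; have [|k l /= hk hl|n hn nk] := @int_subgroup (fun k => x *~ k = 0).
- by rewrite mulr0z.
- by rewrite mulrzBr hk hl subrr.
have [|a a0 an] := @torsion n.
  by apply: contra_neq x0 => n1; rewrite -[x]mulr1z -hn n1.
have h0 : partial_hom [set (0, 0)].
  split=> //= [y z b c [-> ->] [-> ->]|b [->] //]; by rewrite !subrr.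
have [|h [hh hE]] := partial_hom_extension (partial_hom_extend (x := x) (a := a) h0 _).
  move=> k b [/nk[q ->] ->].
  by rewrite mulrC mulrzA -[a *~ n]/(a *+ n) an mul0rz.
exists h; split=> //; rewrite (hE x a) //.
by exists 1; rewrite /= !mulr1z !subrr.
Qed.

End Divisible.

Lemma zmod_morphism_add (A D : zmodType) (f : A -> D) :
  zmod_morphism f -> {morph f : x y / x + y}.
Proof.
move=> fB; pose m := GRing.isZmodMorphism.Build _ _ f fB.
exact: (raddfD (HB.pack_for {additive A -> D} f m)).
Qed.

(** * Coinduced modules and enough injectives *)

Section Coinduced.
Variables (R : pzRingType) (D : zmodType) (L : Type).

(* The product of [L] copies of the R-module Hom_Z(R, D). *)
Definition coind_pred (f : L -> R -> D) : bool :=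
  `[< forall l, zmod_morphism (f l) >].
Record coind := Coind {coind_val :> L -> R -> D; _ : coind_pred coind_val}.
HB.instance Definition _ := [isSub for coind_val].
HB.instance Definition _ := [Choice of coind by <:].

Lemma coindP (f : coind) l : zmod_morphism (f l).
Proof. by case: f => f /= /asboolP. Qed.

Lemma coind_ext (f g : coind) : (forall l r, f l r = g l r) -> f = g.
Proof. by move=> fg; apply: val_inj; apply/funext => l; apply/funext => r; exact: fg. Qed.

Lemma coindD (f : coind) l r s : f l (r + s) = f l r + f l s.
Proof. exact/zmod_morphism_add/coindP. Qed.

Definition mkcoind (f : L -> R -> D) (h : forall l, zmod_morphism (f l)) : coind :=
  Coind (introT (asboolP _) h).

Fact coind_zero_subproof (l : L) : zmod_morphism (fun _ : R => 0 : D).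
Proof. by move=> r s; rewrite subrr. Qed.
Definition coind_zero := mkcoind coind_zero_subproof.

Fact coind_add_subproof (f g : coind) l : zmod_morphism (fun r => f l r + g l r).
Proof. by move=> r s; rewrite !coindP opprD addrACA. Qed.
Definition coind_add f g := mkcoind (coind_add_subproof f g).

Fact coind_opp_subproof (f : coind) l : zmod_morphism (fun r => - f l r).
Proof. by move=> r s; rewrite !coindP opprD. Qed.
Definition coind_opp f := mkcoind (coind_opp_subproof f).

Fact coind_scale_subproof a (f : coind) l : zmod_morphism (fun r => f l (r * a)).
Proof. by move=> r s; rewrite mulrBl coindP. Qed.
Definition coind_scale a f := mkcoind (coind_scale_subproof a f).

Fact coind_addA : associative coind_add.
Proof. by move=> f g h; apply: coind_ext => l r /=; rewrite addrA. Qed.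
Fact coind_addC : commutative coind_add.
Proof. by move=> f g; apply: coind_ext => l r /=; rewrite addrC. Qed.
Fact coind_add0 : left_id coind_zero coind_add.
Proof. by move=> f; apply: coind_ext => l r /=; rewrite add0r. Qed.
Fact coind_addN : left_inverse coind_zero coind_opp coind_add.
Proof. by move=> f; apply: coind_ext => l r /=; rewrite addNr. Qed.
HB.instance Definition _ :=
  GRing.isZmodule.Build coind coind_addA coind_addC coind_add0 coind_addN.

Fact coind_scaleA a b f : coind_scale a (coind_scale b f) = coind_scale (a * b) f.
Proof. by apply: coind_ext => l r /=; rewrite mulrA. Qed.
Fact coind_scale1 : left_id 1 coind_scale.
Proof. by move=> f; apply: coind_ext => l r /=; rewrite mulr1. Qed.
Fact coind_scaleDr : right_distributive coind_scale +%R.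
Proof. by move=> a f g; apply: coind_ext. Qed.
Fact coind_scaleDl f : {morph coind_scale^~ f : a b / a + b}.
Proof. by move=> a b; apply: coind_ext => l r /=; rewrite mulrDr coindD. Qed.
HB.instance Definition _ := GRing.Zmodule_isLmodule.Build R coind
  coind_scaleA coind_scale1 coind_scaleDr coind_scaleDl.

(** Evaluation at 1 turns a linear map into Hom_Z(R, D) into an additive map to [D]. That map
    extends to [N] by divisibility, and [x] is then sent to the function of [r] whose value is that
    of the extension at [r *: x]. *)
Lemma coind_injective :
  (forall (n : nat) (d : D), (0 < n)%N -> exists d', d' *+ n = d) ->
  injective_module coind.
Proof.
move=> divD M N g f hg.
have ext l : exists h : N -> D, zmod_morphism h /\ forall x, h (g x) = f x l 1.
  have [|h [hh hE]] := @partial_hom_extension D divD N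
      [set u | exists x, u = (g x, f x l 1)]%classic.
    split=> [|x y a b [u [-> ->]] [v [-> ->]]|a [u [/esym gu ->]]].
    - by exists 0; rewrite !linear0.
    - by exists (u - v); rewrite !linearB.
    - by rewrite (hg u 0) ?gu ?linear0.
  by exists h; split=> // x; apply: hE; exists x.
have [h hE] := choice ext.
have hZ l x y : h l (x - y) = h l x - h l y by case: (hE l) => ->.
have hD l x y : h l (x + y) = h l x + h l y.
  by apply: zmod_morphism_add => u v; exact: hZ.
have kP x l : zmod_morphism (fun r => h l (r *: x)).
  by move=> r s; rewrite scalerBl hZ.
have [|k kE] := @ex_linear R N coind (fun x => mkcoind (kP x)).
  by move=> a x y; apply: coind_ext => l r /=; rewrite scalerDr scalerA hD.
exists k => x; rewrite kE; apply: coind_ext => l r /=.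
have [_ hgx] := hE l; rewrite -linearZ hgx linearZ /=.
by rewrite mul1r.
Qed.

End Coinduced.

(** The factors are indexed by all additive maps from [M] to Q/Z; injectivity holds because these
    maps separate the elements of [M]. *)
Lemma ex_injective_embedding (R : pzRingType) (M : lmodType R) :
  exists (I : lmodType R) (i : {linear M -> I}), injective_module I /\ injective i.
Proof.
have [D [divD torD]] := ex_QmodZ.
pose L := {h : M -> D | zmod_morphism h}.
have iP x (l : L) : zmod_morphism (fun r : R => sval l (r *: x)).
  by move=> r s; rewrite scalerBl (svalP l).
have [|i iE] := @ex_linear R M (coind R D L) (fun x => mkcoind (iP x)).
  move=> a x y; apply: coind_ext => -[l hl] r /=; rewrite scalerDr scalerA.
  by rewrite zmod_morphism_add.
exists (coind R D L), i; split; first exact: coind_injective.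
apply: linear_inj => x ix; apply/eqP/negPn/negP => x0.
have [h [hh /eqP hx]] := separating_hom divD torD x0; apply: hx.
have := congr1 (fun f : coind R D L => f (exist _ h hh) 1) ix.
by rewrite iE /= scale1r.
Qed.

(** * Modules as an instance of the axioms *)

Section ModuleCategory.
Variable R : pzRingType.

Lemma mod_subKm (A B : lmodType R) (f g : {linear A -> B}) : lsub f (lsub f g) = g.
Proof. by apply: linear_ext => x /=; rewrite opprB addrC subrK. Qed.

Lemma lin_eq0 (A B : lmodType R) (f : {linear A -> B}) :
  f = lzero A B -> forall x, f x = 0.
Proof. by move=> ->. Qed.

Lemma mod_mono (A B D : lmodType R) (i : {linear A -> B}) (p : {linear B -> D})
  (X : lmodType R) (f : {linear X -> A}) :
  mses i p -> lcomp i f = lzero X B -> f = lzero X A.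
Proof.
move=> [hi _ _] /lin_eq0 fi; apply: linear_ext => x; apply: hi.
by have /= -> := fi x; rewrite linear0.
Qed.

Lemma mod_epi (A B D : lmodType R) (i : {linear A -> B}) (p : {linear B -> D})
  (X : lmodType R) (f : {linear D -> X}) :
  mses i p -> lcomp f p = lzero B X -> f = lzero D X.
Proof.
move=> [_ hp _] /lin_eq0 fp; apply: linear_ext => x.
by have [y <-] := hp x; exact: fp.
Qed.

Lemma mod_ker (A B D : lmodType R) (i : {linear A -> B}) (p : {linear B -> D})
  (X : lmodType R) (f : {linear X -> B}) :
  mses i p -> lcomp p f = lzero X D -> exists g, lcomp i g = f.
Proof.
move=> h /lin_eq0 pf; have [g gE] := mses_ker h pf.
by exists g; apply: linear_ext.
Qed.

Lemma mod_coker (A B D : lmodType R) (i : {linear A -> B}) (p : {linear B -> D})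
  (X : lmodType R) (f : {linear B -> X}) :
  mses i p -> lcomp f i = lzero A X -> exists g, lcomp g p = f.
Proof.
move=> h /lin_eq0 pf; have [g gE] := mses_coker h pf.
by exists g; apply: linear_ext.
Qed.

Lemma mod_zero : exists Z : lmodType R, [/\
    forall (A : lmodType R) (f : {linear A -> Z}), f = lzero A Z,
    forall (A : lmodType R) (f : {linear Z -> A}), f = lzero Z A,
    forall A : lmodType R,
      exists (i : {linear A -> A}) (p : {linear A -> Z}), mses i p
    & forall A : lmodType R,
      exists (i : {linear Z -> A}) (p : {linear A -> A}), mses i p].
Proof.
exists (zero_module R); split=> [A f|A f|A|A].
- by apply: linear_ext => x; rewrite [LHS]zero_module0.
- by apply: linear_ext => x; rewrite (zero_module0 x) linear0.
- exists (lid A), (lzero A (zero_module R)); split=> // [y|y].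
    by exists 0; rewrite (zero_module0 y).
  by split=> // _; exists y.
exists (lzero (zero_module R) A), (lid A); split=> // [x y _|y|y].
- by rewrite (zero_module0 x) (zero_module0 y).
- by exists y.
by split=> [/= ->|[x /= <-] //]; exists 0.
Qed.

Lemma mod_enough_proj (M : lmodType R) :
  exists (K P : lmodType R) (i : {linear K -> P}) (p : {linear P -> M}), mses i p /\
    forall (A B D : lmodType R) (j : {linear A -> B}) (q : {linear B -> D})
      (f : {linear P -> D}), mses j q -> exists g, lcomp q g = f.
Proof.
have [P [p [hP hp]]] := ex_projective_surjection M.
have [K [i hip]] := mses_surj hp.
exists K, P, i, p; split=> // A B D j q f [_ hq _].
by have [g gE] := hP _ _ q f hq; exists g; apply: linear_ext.
Qed.

Lemma mod_enough_inj (M : lmodType R) :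
  exists (K I : lmodType R) (i : {linear I -> K}) (p : {linear M -> I}), mses p i /\
    forall (A B D : lmodType R) (j : {linear B -> A}) (q : {linear D -> B})
      (f : {linear D -> I}), mses q j -> exists g, lcomp g q = f.
Proof.
have [I [p [hI hp]]] := ex_injective_embedding M.
have [K [i hip]] := mses_inj hp.
exists K, I, i, p; split=> // A B D j q f [hq _ _].
by have [g gE] := hI _ _ q f hq; exists g; apply: linear_ext.
Qed.

(** Kept transparent, so that objects, maps and exact sequences of [modcat R] reduce to modules,
    linear maps and [mses]. *)
Definition modcat : excat.
Proof.
refine (@Excat (lmodType R) (fun A B => {linear A -> B}) (@lid R) (@lcomp R)
  (@lzero R) (@lsub R) (@mses R) _ _ _ _ mod_subKm _ _ _ mod_mono mod_epi
  mod_ker mod_coker (@mses_flip R) mod_zero (@mses_pullback_mono R)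
  (@mses_pushout_epi R) (@mses_pullback_epi R) (@mses_pushout_mono R)
  mod_enough_proj mod_enough_inj).
- by move=> *; apply: linear_ext.
- by move=> *; apply: linear_ext.
- by move=> *; apply: linear_ext.
- by move=> *; apply: linear_ext => x /=; rewrite subrr.
- by move=> *; apply: linear_ext.
- by move=> A B D f g h; apply: linear_ext => x /=; rewrite linearB.
- by move=> A B D i p h; apply: linear_ext; exact: mses_comp0.
Defined.

End ModuleCategory.

(** * Resolutions as complexes versus recursive resolutions *)

Section Translation.
Variable R : pzRingType.
Implicit Types (G : lmodType R -> Prop) (M N P : lmodType R).

Lemma proj_projective P : @proj (modcat R) P <-> projective_module P.
Proof.
split=> [hP A B g f hg|hP K A B j q [_ hq _] f].
  have [K [i hig]] := mses_surj hg.
  by have [h <-] := hP _ _ _ _ _ hig f; exists h.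
by have [h hE] := hP _ _ q f hq; exists h; apply: linear_ext.
Qed.

Lemma inj_injective P : @inj (modcat R) P <-> injective_module P.
Proof.
split=> [hP A B g f hg|hP K A B q j [hj _ _] f].
  have [K [i hig]] := mses_inj hg.
  by have [h <-] := hP _ _ _ _ _ hig f; exists h.
by have [h hE] := hP _ _ j f hj; exists h; apply: linear_ext.
Qed.

(** A resolution of length 0 only makes [M] isomorphic to a member of [G], whereas [res] asks for
    [M] itself. *)
Definition iso_closed G := forall M N (f : {linear M -> N}),
  injective f -> surjective_map f -> G M -> G N.

Lemma linear_inverse M N (f : {linear M -> N}) : injective f -> surjective_map f ->
  exists g : {linear N -> M}, cancel f g /\ cancel g f.
Proof.
move=> fi fs; have [|g gE] := @linear_factor_inj _ _ _ _ f (lid N) fi.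
  by move=> y; exact: fs.
by exists g; split=> // x; apply: fi; rewrite gE.
Qed.

Lemma projective_iso_closed : iso_closed (@projective_module R).
Proof.
move=> M N f fi fs hM A B g k hg; have [f' [fK f'K]] := linear_inverse fi fs.
have [h hE] := hM _ _ g (lcomp k f) hg; exists (lcomp h f') => x.
by rewrite /= hE /= f'K.
Qed.

Lemma injective_iso_closed : iso_closed (@injective_module R).
Proof.
move=> M N f fi fs hM A B g k hg; have [f' [fK f'K]] := linear_inverse fi fs.
have [h hE] := hM _ _ g (lcomp f' k) hg; exists (lcomp f h) => x.
by rewrite /= hE /= f'K.
Qed.

Lemma syzygy_iso (X : int -> lmodType R) (d : forall i, {linear X (i + 1) -> X i}) :
  iso_closed (is_syzygy d).
Proof.
move=> M N f fi fs [i [j [hj e]]]; have [f' [fK f'K]] := linear_inverse fi fs.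
exists i, (lcomp j f'); split; first exact: inj_comp hj (can_inj f'K).
move=> y; rewrite e; split=> -[x <-]; last by exists (f' x).
by exists (f x); rewrite /= fK.
Qed.

Lemma Gorenstein_projective_iso_closed : iso_closed (@Gorenstein_projective R).
Proof.
by move=> M N f fi fs [X [d [h1 h2 h3 /(syzygy_iso fi fs) h4]]]; exists X, d.
Qed.

Lemma Gorenstein_injective_iso_closed : iso_closed (@Gorenstein_injective R).
Proof.
by move=> M N f fi fs [X [d [h1 h2 h3 /(syzygy_iso fi fs) h4]]]; exists X, d.
Qed.

Lemma has_resolution0 G M : iso_closed G -> has_resolution G M 0 <-> G M.
Proof.
move=> hG; split=> [[P [d [e [hP P0 hs h0 h]]]]|hM].
  apply: (hG _ _ e) (hP 0%N (leqnn _)) => //; apply: linear_inj => x.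
  by move=> /h0[y <-]; rewrite (P0 1%N isT y) linear0.
pose P i : lmodType R := if i is _.+1 then zero_module R else M.
exists P, (fun i => lzero (P i.+1) (P i)), (lid M); split=> //.
- by case.
- by case=> // i _ x; exact: zero_module0.
- by move=> y; exists y.
- by move=> y; split=> [/= ->|[x /= <-]//]; exists 0.
by move=> i y; split=> // _; exists 0; rewrite (zero_module0 y).
Qed.

(** Cut at the kernel of the augmentation; conversely the new first differential is the augmentation
    of [K] followed by its inclusion. *)
Lemma has_resolutionS G M n : has_resolution G M n.+1 <->
  exists K P : lmodType R, [/\ @exact3 (modcat R) K P M, G P & has_resolution G K n].
Proof.
split=> [[P [d [e [hP P0 hs h0 h]]]]|[K [P0 [[k [p [hk hp e]]] hP0 hK]]]].
  have [K [k hke]] := mses_surj hs.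
  have [|e' e'E] := @mses_ker _ _ _ _ _ _ _ (d 0%N) hke.
    by move=> x; apply/h0; exists x.
  have [hk _ hkE] := hke.
  exists K, (P 0%N); split; [by exists k, e|exact: hP|].
  exists (fun i => P i.+1), (fun i => d i.+1), e'; split=> //.
  - by move=> i ni; apply: hP.
  - by move=> i ni; apply: P0.
  - move=> y; have [|x xE] := (h0 (k y)).1; first by apply/hkE; exists y.
    by exists x; apply: hk; rewrite e'E.
  move=> y; rewrite -(h 0%N y) -e'E.
  split=> [->|kk]; first exact: linear0.
  by apply: hk; rewrite kk linear0.
have [P [d [e' [hP PZ hs h0 h]]]] := hK.
pose Q i : lmodType R := if i is j.+1 then P j else P0.
pose dQ i : {linear Q i.+1 -> Q i} :=
  if i is j.+1 return {linear Q i.+1 -> Q i} then d j else lcomp k e'.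
exists Q, dQ, p; split=> //.
- by case=> // i; apply: hP.
- by case=> // i; apply: PZ.
- move=> y; rewrite e; split=> -[x <-]; last by exists (e' x).
  by have [z <-] := hs x; exists z.
case=> [|i] y; last exact: h.
rewrite -h0; split=> [/=|/= ->]; last by rewrite linear0.
by rewrite -(linear0 k) => /hk.
Qed.

Lemma has_resolution_res G M n : iso_closed G ->
  has_resolution G M n <-> @res (modcat R) G M n.
Proof.
move=> hG; elim: n M => [|n IH] M; first exact: has_resolution0.
rewrite has_resolutionS; split=> -[K [P [h hP hK]]]; exists K, P; split=> //; exact/IH.
Qed.

Lemma has_coresolution0 G M : iso_closed G -> has_coresolution G M 0 <-> G M.
Proof.
move=> hG; split=> [[P [d [e [hP P0 hi h0 h]]]]|hM].
  have es : surjective_map e.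
    by move=> y; apply/h0; rewrite (P0 1%N isT (d 0%N y)).
  have [f [fK f'K]] := linear_inverse hi es.
  apply: (hG _ _ f) (hP 0%N (leqnn _)); first exact: can_inj f'K.
  by move=> y; exists (e y).
pose P i : lmodType R := if i is _.+1 then zero_module R else M.
exists P, (fun i => lzero (P i) (P i.+1)), (lid M); split=> //.
- by case.
- by case=> // i _ x; exact: zero_module0.
- by move=> y; split=> // _; exists y.
by move=> i y; split=> // _; exists 0; rewrite (zero_module0 y).
Qed.

Lemma has_coresolutionS G M n : has_coresolution G M n.+1 <->
  exists K P : lmodType R, [/\ @exact3 (modcat R) M P K, G P & has_coresolution G K n].
Proof.
split=> [[P [d [e [hP P0 hi h0 h]]]]|[K [P0 [[k [p [hk hp e]]] hP0 hK]]]].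
  have [K [k hke]] := mses_inj hi.
  have [|e' e'E] := @mses_coker _ _ _ _ _ _ _ (d 0%N) hke.
    by move=> x; apply/h0; exists x.
  have [_ hk hkE] := hke.
  exists K, (P 0%N); split; [by exists e, k|exact: hP|].
  exists (fun i => P i.+1), (fun i => d i.+1), e'; split=> //.
  - by move=> i ni; apply: hP.
  - by move=> i ni; apply: P0.
  - apply: linear_inj => y; have [x <-] := hk y; rewrite e'E => /h0 dx.
    exact/hkE.
  move=> y; rewrite (h 0%N y); split=> -[x <-]; first by exists (k x); rewrite e'E.
  by have [z <-] := hk x; exists z; rewrite e'E.
have [P [d [e' [hP PZ hs h0 h]]]] := hK.
pose Q i : lmodType R := if i is j.+1 then P j else P0.
pose dQ i : {linear Q i -> Q i.+1} :=
  if i is j.+1 return {linear Q i -> Q i.+1} then d j else lcomp e' p.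
exists Q, dQ, k; split=> //.
- by case=> // i; apply: hP.
- by case=> // i; apply: PZ.
- move=> y; rewrite -e; split=> [/= |/= ->]; last by rewrite linear0.
  by rewrite -(linear0 e') => /hs.
case=> [|i] y; last exact: h.
rewrite h0; split=> -[x <-]; last by exists (p x).
by have [z <-] := hp x; exists z.
Qed.

Lemma has_coresolution_cores G M n : iso_closed G ->
  has_coresolution G M n <-> @cores (modcat R) G M n.
Proof.
move=> hG; elim: n M => [|n IH] M; first exact: has_coresolution0.
rewrite has_coresolutionS; split=> -[K [P [h hP hK]]]; exists K, P; split=> //;
  [exact/op_ex|exact/IH|exact/op_ex|exact/IH].
Qed.

End Translation.

(** Iterate a chosen successor and a chosen predecessor of [t0]; [Negz n] is [-(n + 1)], hence the
    [n.+1] backward steps. *)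
Lemma int_chain (T : Type) (S : T -> T -> Prop) (t0 : T) :
  (forall t, exists u, S t u) -> (forall t, exists u, S u t) ->
  exists F : int -> T, F 0 = t0 /\ forall i, S (F i) (F (i + 1)).
Proof.
move=> /choice[nx nxP] /choice[pv pvP].
exists (fun i => match i with Posz n => iter n nx t0 | Negz n => iter n.+1 pv t0 end).
split=> // -[n|[|n]].
- by rewrite (_ : Posz n + 1 = Posz n.+1) ?iterS // intS addrC.
- exact: pvP.
rewrite (_ : Negz n.+1 + 1 = Negz n); first exact: pvP.
by rewrite !NegzE [n.+2%:Z]intS opprD addrAC addNr add0r.
Qed.

(** * Totally acyclic complexes versus the coinductive classes *)

Section Gorenstein.
Variable R : pzRingType.
Implicit Types (M N P : lmodType R).

Lemma splice_complex (G Q : lmodType R -> Prop) M : G M ->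
  (forall N, G N -> exists P N', [/\ Q P, @exact3 (modcat R) N P N' & G N']) ->
  (forall N, G N -> exists P N', [/\ Q P, @exact3 (modcat R) N' P N & G N']) ->
  exists (Z X : int -> lmodType R) (j : forall i, {linear Z (i + 1) -> X i})
         (q : forall i, {linear X i -> Z i}),
  [/\ Z 0 = M, forall i, G (Z i), forall i, Q (X i) & forall i, mses (j i) (q i)].
Proof.
move=> hM next prev; pose T := {N : lmodType R | G N}.
(* Differentials lower the index, so the successor in the chain is the kernel and the predecessor
   the cokernel. *)
pose S (N N' : T) := exists2 P, Q P & @exact3 (modcat R) (sval N') P (sval N).
have [[N hN]|[N hN]|F [F0 FS]] := @int_chain T S (exist _ M hM).
- by have [P [N' [hP h hN']]] := prev _ hN; exists (exist _ N' hN'), P.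
- by have [P [N' [hP h hN']]] := next _ hN; exists (exist _ N' hN'), P.
have e i : exists P : lmodType R, Q P /\
    @exact3 (modcat R) (sval (F (i + 1))) P (sval (F i)).
  by have [P hP h] := FS i; exists P.
pose X i := projT1 (cid (e i)).
have eX i : Q (X i) /\ @exact3 (modcat R) (sval (F (i + 1))) (X i) (sval (F i)).
  exact: projT2 (cid (e i)).
pose j i := projT1 (cid (eX i).2).
pose q i := projT1 (cid (projT2 (cid (eX i).2))).
exists (fun i => sval (F i)), X, j, q; split=> [|i|i|i].
- by rewrite F0.
- exact: svalP.
- exact: (eX i).1.
exact: projT2 (cid (projT2 (cid (eX i).2))).
Qed.

Section Splice.
Variables (Z X : int -> lmodType R) (j : forall i, {linear Z (i + 1) -> X i})
  (q : forall i, {linear X i -> Z i}).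
Hypothesis jq : forall i, mses (j i) (q i).
Let d i := lcomp (j i) (q (i + 1)).

Lemma splice_ker i x : d i x = 0 <-> q (i + 1) x = 0.
Proof.
split=> [/=|/= ->]; last exact: linear0.
by have [ji _ _] := jq i; rewrite -(linear0 (j i)) => /ji.
Qed.

Lemma splice_exact : exact_complex d.
Proof.
move=> i y; rewrite splice_ker; have [_ _ e] := jq (i + 1); rewrite e.
have [_ qs _] := jq (i + 1 + 1).
split=> -[x <-]; last by exists (q (i + 1 + 1) x).
by have [z <-] := qs x; exists z.
Qed.

Lemma splice_syzygy : is_syzygy d (Z 0).
Proof.
(* [j (- 1)] embeds [Z 0] in [X (- 1)], the source of [d (- 2)]; the index sums agree by
   computation. *)
exists (- 2), (j (- 1)); split; first by have [] := jq (- 1).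
move=> y; rewrite (@splice_ker (- 2) y).
by have [_ _ e] := jq (- 1); exact: e.
Qed.

(** A cocycle factors through [Z (i + 1)], and the factor extends along [j i] because Ext^1(Z i, Q)
    = 0. *)
Lemma splice_Hom_into Q :
  (forall i, @ext0 (modcat R) (Z i) Q) -> Hom_into_exact d Q.
Proof.
move=> hQ i f; split=> [fd|[g gE] x]; last first.
  rewrite -gE (_ : d i _ = 0) ?linear0 //.
  by apply/splice_exact; exists x.
have [_ qs _] := jq (i + 1 + 1).
have [g gE] : exists g : {linear Z (i + 1) -> Q}, forall x, g (q (i + 1) x) = f x.
  apply: mses_coker (jq (i + 1)) _ => x; have [y <-] := qs x; exact: fd.
have [h hE] := coext0_ext0 (hQ i) (jq i : @ses (modcat R) _ _ _ _ _) g.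
by exists h => x; rewrite -gE -[g]hE.
Qed.

(** A cycle lands in [Z (i + 1 + 1)] and lifts along [q (i + 1 + 1)], since Ext^1 from [E] to the
    kernel of that map vanishes. *)
Lemma splice_Hom_from E :
  (forall i, @ext0 (modcat R) E (Z i)) -> Hom_from_exact d E.
Proof.
move=> hE i f; split=> [df|[g gE] x]; last first.
  by rewrite -gE; apply/splice_exact; exists (g x).
have [g gE] : exists g : {linear E -> Z (i + 1 + 1)}, forall x, j (i + 1) (g x) = f x.
  by apply: mses_ker (jq (i + 1)) _ => x; apply/splice_ker.
have [h hE'] := hE _ _ _ _ _ (jq (i + 1 + 1) : @ses (modcat R) _ _ _ _ _) g.
by exists h => x; rewrite -gE -hE'.
Qed.

End Splice.

Section Syzygies.
Variables (X : int -> lmodType R) (d : forall i, {linear X (i + 1) -> X i}).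
Hypothesis dX : exact_complex d.

(** The kernel of [d i] is the image of [d (i + 1)], so it is covered by the next term, with the
    next syzygy as kernel. *)
Lemma syzygy_cover i N (k : {linear N -> X (i + 1)}) :
  injective k -> exact_at k (d i) ->
  exists N' (k' : {linear N' -> X (i + 1 + 1)}) (p : {linear X (i + 1 + 1) -> N}),
    [/\ exact_at k' (d (i + 1)), mses k' p & forall x, k (p x) = d (i + 1) x].
Proof.
move=> hk ke.
have [|p pE] := @linear_factor_inj _ _ _ _ k (d (i + 1)) hk.
  by move=> x; apply/ke/dX; exists x.
have [N' [k' [hk' ke']]] := ex_kernel (d (i + 1)).
exists N', k', p; split=> //; split=> // y.
  have [|x xE] := (dX (k y)).1; first by apply/ke; exists y.
  by exists x; apply: hk; rewrite pE.
rewrite -ke' -pE; split=> [->|py]; first exact: linear0.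
by apply: hk; rewrite py linear0.
Qed.

Lemma syzygy_embed M : is_syzygy d M ->
  exists i (k : {linear M -> X (i + 1 + 1)}) N (n : {linear N -> X (i + 1)})
    (p : {linear X (i + 1 + 1) -> N}),
    [/\ exact_at n (d i), mses k p, injective n & forall x, n (p x) = d (i + 1) x].
Proof.
move=> [i0 [k [hk ke]]].
(* The cokernel is a kernel one degree lower; writing [i0] as [i + 1] avoids transporting between
   [X (i0 - 1 + 1)] and [X i0]. *)
have [i iE] : exists i, i0 = i + 1 by exists (i0 - 1); rewrite subrK.
subst i0; have [N [n [hn ne]]] := ex_kernel (d i).
have [|p pE] := @linear_factor_inj _ _ _ _ n (d (i + 1)) hn.
  by move=> x; apply/ne/dX; exists x.
exists i, k, N, n, p; split=> //; split=> // y.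
  have [|x xE] := (dX (n y)).1; first by apply/ne; exists y.
  by exists x; apply: hn; rewrite pE.
rewrite -ke -pE; split=> [->|py]; first exact: linear0.
by apply: hn; rewrite py linear0.
Qed.

Lemma syzygy_next M : is_syzygy d M ->
  exists i N, @exact3 (modcat R) M (X i) N /\ is_syzygy d N.
Proof.
move=> /syzygy_embed[i [k [N [n [p [ne kp hn _]]]]]].
by exists (i + 1 + 1), N; split; [exists k, p|exists i, n].
Qed.

Lemma syzygy_prev M : is_syzygy d M ->
  exists i N, @exact3 (modcat R) N (X i) M /\ is_syzygy d N.
Proof.
move=> [i [k [hk ke]]]; have [N [k' [p [h1 h2 _]]]] := syzygy_cover hk ke.
exists (i + 1 + 1), N; split; first by exists k', p.
by exists (i + 1), k'; split=> //; case: h2.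
Qed.

Lemma syzygy_ext0 M Q : (forall i, projective_module (X i)) ->
  Hom_into_exact d Q -> is_syzygy d M -> @ext0 (modcat R) M Q.
Proof.
move=> hX dQ [i [k [hk ke]]]; have [N [k' [p [h1 h2 _]]]] := syzygy_cover hk ke.
have [hk' _ _] := h2; have [N2 [k2 [p' [_ h2' pE']]]] := syzygy_cover hk' h1.
apply: (@ext0_coker (modcat R) _ _ _ _ k' p h2).
  exact: (iffRL (proj_projective _) (hX _)).
(* Composed with the cover [p'] of [N], [f] becomes a cocycle, hence a coboundary; as [p'] is
   surjective, the bounding map extends [f]. *)
move=> f; have [|g gE] := (dQ (i + 1 + 1) (lcomp f p')).1.
  move=> x /=; rewrite (_ : p' _ = 0) ?linear0 //; apply: hk'.
  by rewrite pE' linear0; apply/dX; exists x.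
exists g; apply: linear_ext => x; have [_ ps _] := h2'.
by have [y <-] := ps x; rewrite /= pE' gE.
Qed.

(** A map from [E] to the cokernel [N] of [M] is a cycle once included in the complex, so it lifts
    to the injective term containing [M]; this kills Ext^1(E, M). *)
Lemma syzygy_coext0 M E : (forall i, injective_module (X i)) ->
  Hom_from_exact d E -> is_syzygy d M -> @ext0 (modcat R) E M.
Proof.
move=> hX dE /syzygy_embed[i [k [N [n [p [ne kp hn pE]]]]]].
apply: ext0_coext0.
apply: (@ext0_coker (opcat (modcat R)) _ _ _ _ p k kp).
  apply: (@coext0_ext0 (modcat R)); apply: inj_ext0.
  exact: (iffRL (inj_injective _) (hX _)).
move=> f; have [|g gE] := (dE i (lcomp n f)).1.
  by move=> x /=; apply/ne; exists (f x).
by exists g; apply: linear_ext => x; apply: hn; rewrite /= pE gE.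
Qed.

End Syzygies.

Lemma Gorenstein_projective_gproj M :
  Gorenstein_projective M <-> @gproj (modcat R) M.
Proof.
split=> [[X [d [hX dX dQ hM]]]|[G hM hG]].
  exists (is_syzygy d) => // N hN; split.
  - have [i [K [h hK]]] := syzygy_next dX hN.
    by exists (X i), K; split=> //; exact/proj_projective.
  - have [i [K [h hK]]] := syzygy_prev dX hN.
    by exists (X i), K; split=> //; exact/proj_projective.
  move=> Q /proj_projective hQ; exact: syzygy_ext0 (dQ _ hQ) hN.
have [N /hG[]//|N /hG[]//|Z [X [j [q [ZM hZ hX jq]]]]] :=
  @splice_complex G (@proj (modcat R)) M hM.
exists X, (fun i => lcomp (j i) (q (i + 1))); split.
- by move=> i; apply/proj_projective.
- exact: splice_exact.
- move=> Q /proj_projective hQ; apply: splice_Hom_into => // i.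
  by have [_ _] := hG _ (hZ i); apply.
by rewrite -ZM; exact: splice_syzygy.
Qed.

Lemma Gorenstein_injective_ginj M :
  Gorenstein_injective M <-> @ginj (modcat R) M.
Proof.
split=> [[X [d [hX dX dE hM]]]|[G hM hG]].
  exists (is_syzygy d) => // N hN; split.
  - have [i [K [h hK]]] := syzygy_prev dX hN.
    by exists (X i), K; split=> //; [exact/inj_injective|exact/op_ex].
  - have [i [K [h hK]]] := syzygy_next dX hN.
    by exists (X i), K; split=> //; [exact/inj_injective|exact/op_ex].
  move=> E /inj_injective hE.
  exact: (coext0_ext0 (syzygy_coext0 dX hX (dE _ hE) hN)).
have [N /hG[_ [P [N' [hP /op_ex h hN']]] _]|N /hG[[P [N' [hP /op_ex h hN']]] _ _]|
    Z [X [j [q [ZM hZ hX jq]]]]] := @splice_complex G (@inj (modcat R)) M hM.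
- by exists P, N'.
- by exists P, N'.
exists X, (fun i => lcomp (j i) (q (i + 1))); split.
- by move=> i; apply/inj_injective.
- exact: splice_exact.
- move=> E /inj_injective hE; apply: splice_Hom_from => // i.
  by have [_ _ h] := hG _ (hZ i); apply: ext0_coext0; apply: h.
by rewrite -ZM; exact: splice_syzygy.
Qed.

End Gorenstein.

(** * Dimensions *)

Definition dimension (a : \bar int) : Prop :=
  a = +oo%E \/ exists n : nat, a = (n%:Z)%:E%E.

Lemma dimension_ge0 a : dimension a -> (0%:E <= a)%E.
Proof. by case=> [->|[n ->]]; rewrite ?leey // lee_fin. Qed.

(** A dimension is determined by its natural upper bounds; both equalities of the theorem are
    obtained by comparing bounds. *)
Lemma dimension_eq a b : dimension a -> dimension b ->
  (forall m : nat, (a <= (m%:Z)%:E)%E <-> (b <= (m%:Z)%:E)%E) -> a = b.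
Proof.
case=> [->|[n ->]] [->|[k ->]] // h.
- by have := (h k).2 (lexx _).
- by have := (h n).1 (lexx _).
by apply/le_anti; rewrite (h k).2 // (h n).1.
Qed.

Lemma least_length_dimension (L : set nat) : dimension (least_length L) /\
  forall m : nat, (least_length L <= (m%:Z)%:E)%E <-> exists2 n, (n <= m)%N & L n.
Proof.
rewrite /least_length; have [[n Ln]|L0] := pselect (exists n, L n); last first.
  have -> : L = set0.
    by apply/seteqP; split=> // n Ln; apply: L0; exists n.
  rewrite image_set0 /infimum eqxx; split; first by left.
  by move=> m; split=> // -[].
have Lex : exists n, `[< L n >] by exists n; apply/asboolP.
have [k /asboolP Lk kmin] := ex_minnP Lex.
have -> : infimum +oo%E [set (n%:Z)%:E%E | n in L] = (k%:Z)%:E%E.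
  rewrite /infimum ifF; last by apply/negbTE/set0P; exists (n%:Z)%:E%E, n.
  have kinf : infimums [set (n%:Z)%:E%E | n in L] (k%:Z)%:E%E.
    split; last by move=> b; apply; exists k.
    by move=> _ [l Ll <-]; rewrite lee_fin lez_nat; apply/kmin/asboolP.
  by apply: xget_unique => // y hy; exact: is_subset1_infimums hy kinf.
split=> [|m]; first by right; exists k.
rewrite lee_fin lez_nat; split=> [km|[l lm Ll]]; first by exists k.
by apply: leq_trans lm; apply/kmin/asboolP.
Qed.

Lemma sup_dim_dimension (A : set (\bar int)) : (exists a, A a) ->
  (forall a, A a -> dimension a) -> dimension (sup_dim A) /\
  forall m : nat, (sup_dim A <= (m%:Z)%:E)%E <-> forall a, A a -> (a <= (m%:Z)%:E)%E.
Proof.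
move=> [a Aa] hA; rewrite /sup_dim.
have supE s : supremums A s -> supremum -oo%E A = s.
  move=> hs; rewrite /supremum ifF; last by apply/negbTE/set0P; exists a.
  by apply: xget_unique => // y hy; exact: is_subset1_supremums hy hs.
pose B (m : nat) := `[< forall a, A a -> (a <= (m%:Z)%:E)%E >].
(* [A] has a nonnegative element, which excludes negative integers and [-oo] as upper bounds. *)
have ubB b : ubound A b -> b = +oo%E \/ exists2 m : nat, b = (m%:Z)%:E%E & B m.
  move=> hb; have := le_trans (dimension_ge0 (hA _ Aa)) (hb _ Aa).
  case: b hb => [[m|m]| |] // hb _; last by left.
  by right; exists m => //; apply/asboolP.
have [[n Bn]|nB] := pselect (exists n, B n).
  have [k Bk kmin] := ex_minnP (ex_intro B n Bn).
  rewrite (supE (k%:Z)%:E%E); last first.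
    split; first exact/asboolP.
    by move=> b /ubB[->|[m -> /kmin km]]; rewrite ?leey // lee_fin lez_nat.
  split; first by right; exists k.
  move=> m; rewrite lee_fin lez_nat; split=> [km b /(asboolP _ Bk) bk|/asboolP/kmin //].
  by apply: le_trans bk _; rewrite lee_fin lez_nat.
rewrite (supE +oo%E); last first.
  split; first by move=> b _; exact: leey.
  by move=> b /ubB[->|[m _ Bm]] //; case: nB; exists m.
split; first by left.
by move=> m; split=> // hm; case: nB; exists m; apply/asboolP.
Qed.

(** * The four global dimensions expressed by the abstract bounds *)

Section GlobalDimension.
Variable R : pzRingType.
Implicit Types (G : lmodType R -> Prop) (M P : lmodType R).

(** Lets a resolution of length [n] count as one of any length [m] above [n]: the zero modules in
    degrees [n + 1] to [m] must lie in [G]. *)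
Definition zero_closed G := forall M, (forall x : M, x = 0) -> G M.

Lemma resolution_length_le G M m : zero_closed G ->
  (least_length [set n | has_resolution G M n] <= (m%:Z)%:E)%E <->
  has_resolution G M m.
Proof.
move=> hG; rewrite (least_length_dimension _).2; split=> [|h]; last by exists m.
move=> [n nm [P [d [e [hP P0 hs h0 h]]]]]; exists P, d, e; split=> // i im.
  by case: (leqP i n) => [/hP//|/P0 /hG].
by apply: P0; exact: leq_ltn_trans im.
Qed.

Lemma coresolution_length_le G M m : zero_closed G ->
  (least_length [set n | has_coresolution G M n] <= (m%:Z)%:E)%E <->
  has_coresolution G M m.
Proof.
move=> hG; rewrite (least_length_dimension _).2; split=> [|h]; last by exists m.
move=> [n nm [P [d [e [hP P0 hs h0 h]]]]]; exists P, d, e; split=> // i im.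
  by case: (leqP i n) => [/hP//|/P0 /hG].
by apply: P0; exact: leq_ltn_trans im.
Qed.

Lemma projective_zero : zero_closed (@projective_module R).
Proof.
move=> P P0 M N g f hg; exists (lzero P M) => x.
by rewrite (P0 x) !linear0.
Qed.

Lemma injective_zero : zero_closed (@injective_module R).
Proof.
by move=> P P0 M N g f hg; exists (lzero N P) => x; rewrite (P0 (f x)).
Qed.

Lemma zero_complex M : (forall x : M, x = 0) ->
  let X := fun _ : int => zero_module R in
  let d := fun i : int => lzero (X (i + 1)) (X i) in
  [/\ exact_complex d, forall Q, Hom_into_exact d Q, forall E, Hom_from_exact d E
    & is_syzygy d M].
Proof.
move=> M0 X d; split=> [i y|Q i f|E i f|].
- by split=> // _; exists 0; rewrite (zero_module0 y).
- split=> [_|[g gE] x]; last by rewrite -gE (zero_module0 x) !linear0.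
  by exists (lzero _ _) => x; rewrite (zero_module0 x) !linear0.
- split=> [_|[g gE] x]; last exact: zero_module0.
  by exists (lzero _ _) => x; rewrite (zero_module0 (f x)).
exists 0, (lzero M (zero_module R)); split; first by move=> x y _; rewrite (M0 x).
by move=> y; split=> // _; exists 0; rewrite (zero_module0 y).
Qed.

Lemma Gorenstein_projective_zero : zero_closed (@Gorenstein_projective R).
Proof.
move=> M /zero_complex[h1 h2 _ h4]; do 2!eexists; split; [|exact: h1| |exact: h4].
  by move=> i; apply: projective_zero; exact: zero_module0.
by move=> Q _; exact: h2.
Qed.

Lemma Gorenstein_injective_zero : zero_closed (@Gorenstein_injective R).
Proof.
move=> M /zero_complex[h1 _ h3 h4]; do 2!eexists; split; [|exact: h1| |exact: h4].
  by move=> i; apply: injective_zero; exact: zero_module0.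
by move=> Q _; exact: h3.
Qed.

Lemma silpP : dimension (silp R) /\
  forall m : nat, (silp R <= (m%:Z)%:E)%E <-> silp_le (modcat R) m.
Proof.
have [||h1 h2] := @sup_dim_dimension [set a | exists2 P : lmodType R,
    projective_module P & id_dim P = a]%classic.
- exists (id_dim (zero_module R)), (zero_module R) => //.
  by apply: projective_zero; exact: zero_module0.
- by move=> _ [P _ <-]; exact: (least_length_dimension _).1.
split=> // m; rewrite /silp h2; split=> [h P /proj_projective hP|h _ [P hP <-]].
  apply: (@res_mono (opcat (modcat R)) (@injective_module R)).
    by move=> I /inj_injective.
  apply/has_coresolution_cores; first exact: injective_iso_closed.
  by apply/coresolution_length_le; [exact: injective_zero|apply: h; exists P].
apply/coresolution_length_le; first exact: injective_zero.
apply/has_coresolution_cores; first exact: injective_iso_closed.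
apply: (@res_mono (opcat (modcat R)) (@inj (modcat R))).
  by move=> I /inj_injective.
by apply/h/proj_projective.
Qed.

Lemma spliP : dimension (spli R) /\
  forall m : nat, (spli R <= (m%:Z)%:E)%E <-> spli_le (modcat R) m.
Proof.
have [||h1 h2] := @sup_dim_dimension [set a | exists2 I : lmodType R,
    injective_module I & pd I = a]%classic.
- exists (pd (zero_module R)), (zero_module R) => //.
  by apply: injective_zero; exact: zero_module0.
- by move=> _ [P _ <-]; exact: (least_length_dimension _).1.
split=> // m; rewrite /spli h2; split=> [h I /inj_injective hI|h _ [I hI <-]].
  apply: (@res_mono (modcat R) (@projective_module R)).
    by move=> P /proj_projective.
  apply/has_resolution_res; first exact: projective_iso_closed.
  by apply/resolution_length_le; [exact: projective_zero|apply: h; exists I].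
apply/resolution_length_le; first exact: projective_zero.
apply/has_resolution_res; first exact: projective_iso_closed.
apply: (@res_mono (modcat R) (@proj (modcat R))).
  by move=> P /proj_projective.
by apply/h/inj_injective.
Qed.

Lemma sup_GpdP : dimension (sup_Gpd R) /\
  forall m : nat, (sup_Gpd R <= (m%:Z)%:E)%E <->
    silp_le (modcat R) m /\ spli_le (modcat R) m.
Proof.
have [||h1 h2] := @sup_dim_dimension [set a | exists M : lmodType R, Gpd M = a]%classic.
- by exists (Gpd (zero_module R)), (zero_module R).
- by move=> _ [M <-]; exact: (least_length_dimension _).1.
split=> // m; rewrite /sup_Gpd h2 -gproj_finite; split=> [h M|h _ [M <-]].
  apply: (@res_mono (modcat R) (@Gorenstein_projective R)).
    by move=> N /Gorenstein_projective_gproj.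
  apply/has_resolution_res; first exact: Gorenstein_projective_iso_closed.
  by apply/resolution_length_le; [exact: Gorenstein_projective_zero|apply: h; exists M].
apply/resolution_length_le; first exact: Gorenstein_projective_zero.
apply/has_resolution_res; first exact: Gorenstein_projective_iso_closed.
apply: (@res_mono (modcat R) (@gproj (modcat R))) (h M).
by move=> N /Gorenstein_projective_gproj.
Qed.

Lemma sup_GidP : dimension (sup_Gid R) /\
  forall m : nat, (sup_Gid R <= (m%:Z)%:E)%E <->
    silp_le (modcat R) m /\ spli_le (modcat R) m.
Proof.
have [||h1 h2] := @sup_dim_dimension [set a | exists M : lmodType R, Gid M = a]%classic.
- by exists (Gid (zero_module R)), (zero_module R).
- by move=> _ [M <-]; exact: (least_length_dimension _).1.
split=> // m; rewrite /sup_Gid h2 -ginj_finite; split=> [h M|h _ [M <-]].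
  apply: (@res_mono (opcat (modcat R)) (@Gorenstein_injective R)).
    by move=> N /Gorenstein_injective_ginj.
  apply/has_coresolution_cores; first exact: Gorenstein_injective_iso_closed.
  by apply/coresolution_length_le; [exact: Gorenstein_injective_zero|apply: h; exists M].
apply/coresolution_length_le; first exact: Gorenstein_injective_zero.
apply/has_coresolution_cores; first exact: Gorenstein_injective_iso_closed.
apply: (@res_mono (opcat (modcat R)) (@ginj (modcat R))) (h M).
by move=> N /Gorenstein_injective_ginj.
Qed.

End GlobalDimension.

Theorem corollary4p11 (R : pzRingType) :
  (forall m : nat,
     [<-> (sup_Gpd R <= (m%:Z)%:E)%E;
          (sup_Gid R <= (m%:Z)%:E)%E;
          spli R = silp R /\ (silp R <= (m%:Z)%:E)%E ])
  /\ sup_Gpd R = sup_Gid R.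
Proof.
have [dGpd GpdE] := sup_GpdP R; have [dGid GidE] := sup_GidP R.
have [dsilp silpE] := silpP R; have [dspli spliE] := spliP R.
split=> [m|]; last by apply: dimension_eq => // m; rewrite GpdE GidE.
tfae.
- by rewrite GpdE GidE.
(* Both dimensions are now finite, so every bound [b] on one of them transfers to the other. *)
- rewrite GidE silpE => -[hs hp]; split=> //.
  apply: dimension_eq => // b; rewrite spliE silpE.
  by split=> hb; [exact: spli_silp hb hs|exact: silp_spli hb hp].
by move=> [e h]; rewrite GpdE -silpE -spliE e.
Qed.
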